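(* Let $\mathbb{G}$ be a connected adequate ribbon graph. Then $$hw(\widetilde{Kh}(\mathbb{G}))=g(\mathbb{G})+1.$$
   Context: **Ribbon graphs.** A ribbon graph $\mathbb{G}$ (always oriented) is a finite nonempty graph (loops and multiple edges allowed) together with an embedding into a closed oriented surface $\Sigma$ whose complement is a disjoint union of open disks (faces); equivalently, a graph with a cyclic order of the half-edges at each vertex. The genus $g(\mathbb{G})$ is the genus of $\Sigma$. $\Sigma_{\mathbb{G}}$ is a regular neighborhood of $\mathbb{G}$ in $\Sigma$: one disk per vertex and one band per edge. $F(\mathbb{G})$ is the set of boundary components of $\Sigma_{\mathbb{G}}$. A spanning ribbon subgraph $\mathbb{H}$ has the same vertices, a subset of the edges, and inherited cyclic orders; it has its own $\Sigma_{\mathbb{H}}$ and $F(\mathbb{H})$. The dual ribbon graph $\mathbb{G}^*\subset\Sigma$ has one vertex in each face of $\mathbb{G}$ and, for each edge $e$ of $\mathbb{G}$, an edge $e^*$ crossing $e$ transversely once and joining the two (not necessarily distinct) faces along $e$. $\mathbb{G}$ is adequate if neither $\mathbb{G}$ nor $\mathbb{G}^*$ has a loop (an edge joining a vertex to itself). **Reduced Khovanov homology.** $(M[r]\{s\})^{i,j}=M^{i-r,j-s}$ ($i$ homological, $j$ polynomial grading). $V$ is free abelian on $v_+,v_-$ in bigradings $(0,1),(0,-1)$. $m:V\otimes V\to V$: $v_+\otimes v_+\mapsto v_+$, $v_+\otimes v_-\mapsto v_-$, $v_-\otimes v_+\mapsto v_-$, $v_-\otimes v_-\mapsto 0$. $\Delta:V\to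 V\otimes V$: $v_+\mapsto v_+\otimes v_-+v_-\otimes v_+$, $v_-\mapsto v_-\otimes v_-$. Let $\mathbb{G}$ have edges $e_1,\dots,e_n$. For $I=(m_1,\dots,m_n)\in\{0,1\}^n$ let $h(I)=\sum m_i$, let $\mathbb{G}(I)$ be the spanning ribbon subgraph with edge set $\{e_i:m_i=1\}$, and $CKh(\mathbb{G})=\bigoplus_I V^{\otimes F(\mathbb{G}(I))}[h(I)]\{h(I)\}$. If $J$ is obtained from $I$ by changing the $k$th coordinate from $0$ to $1$ (a hypercube edge $\xi$), adding the band of $e_k$ merges two boundary components or splits one into two; $d_\xi$ is $m$ (merge) or $\Delta$ (split) on the affected factors and the identity on the others. $d=\sum_\xi(-1)^{|\{i<k:\,m_i=1\}|}d_\xi$ raises $i$ by 1 and preserves $j$. Fix a marked point on the boundary of a vertex disk of $\Sigma_{\mathbb{G}}$ away from all bands; $\widetilde{CKh}(\mathbb{G})$ is the subcomplex in which the factor of the boundary component containing the marked point is $\mathbb{Z}v_-$, with polynomial grading shifted up by $1$; $\widetilde{Kh}(\mathbb{G})=\bigoplus\widetilde{Kh}^{i,j}(\mathbb{G})$ is its homology. **Homological width.** The diagonal grading is $\delta=j/2-i$. With $\delta_{\max}$, $\delta_{\min}$ the maximum and minimum $\delta$ for which the summand of $\widetilde{Kh}(\mathbb{G})$ in diagonal grading $\delta$ is nonzero, $hw(\widetilde{Kh}(\mathbb{G}))=\delta_{\max}-\delta_{\min}+1$. *)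

(* Defs.v *)
From HB Require Import structures.
From mathcomp Require Import all_boot all_order all_algebra all_fingroup.
From mathcomp Require Import boolp.

Set Implicit Arguments.
Unset Strict Implicit.
Unset Printing Implicit Defensive.

Import Order.TTheory GRing.Theory Num.Theory.
Local Open Scope ring_scope.

(* The edges are e_0, ..., e_(n-1); the half-edges of e_k are (k, false) and   *)
(* (k, true).  [rot] sends a half-edge to the next one counterclockwise around *)
(* its vertex, so its orbits are the fibres of [vert].  A vertex outside the   *)
(* image of [vert] is isolated.                                                *)
Record ribbonGraph := RibbonGraph {
  vertex : finType;
  nedge : nat;
  vert : 'I_nedge * bool -> vertex;
  rot : {perm 'I_nedge * bool};
  rot_vert : forall x y, (vert x == vert y) = (y \in porbit rot x);
  vertex_gt0 : (0 < #|vertex|)%N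
}.

Section RibbonGraphTheory.

Variable G : ribbonGraph.

Definition edge : finType := 'I_(nedge G).
Definition halfedge : finType := (edge * bool)%type.

(* The bands of Sigma_G cut the boundaries of the vertex disks into arcs:      *)
(* [inl x] is the arc from the half-edge x counterclockwise to [rot G x], and  *)
(* [inr v] is the whole boundary circle of the disk of an isolated vertex.     *)
Definition bnd_arc : finType :=
  (halfedge + {v : vertex G | v \notin codom (@vert G)})%type.

(* The boundary of Sigma_H, where H is the spanning ribbon subgraph with edge  *)
(* set I, is followed with the surface on the left.  From the arc x it reaches *)
(* the half-edge [rot G x].  If the edge is not in H there is no band and it   *)
(* goes on to the next arc of the same disk; otherwise it follows the band and *)
(* arrives just after the opposite half-edge.                                  *)
Definition cross (I : {set edge}) (x : halfedge) : halfedge :=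
  if x.1 \in I then (x.1, ~~ x.2) else x.

Definition bnd_next (I : {set edge}) (a : bnd_arc) : bnd_arc :=
  match a with
  | inl x => inl (cross I (rot G x))
  | inr v => inr v
  end.

Lemma crossK I : involutive (cross I).
Proof.
by case=> k b; rewrite /cross /=; case kI: (k \in I); rewrite /= kI ?negbK.
Qed.

Lemma bnd_next_inj I : injective (bnd_next I).
Proof.
move=> [x|v] [y|w] //= [].
by move/(can_inj (crossK I))/perm_inj => ->.
Qed.

Definition bnd_perm (I : {set edge}) : {perm bnd_arc} :=
  perm (@bnd_next_inj I).

(* F(H): a boundary component is encoded as the set of arcs it contains.       *)
Definition bcomp (I : {set edge}) (a : bnd_arc) : {set bnd_arc} :=
  porbit (bnd_perm I) a.
Definition bcomps (I : {set edge}) : {set {set bnd_arc}} :=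
  porbits (bnd_perm I).

Definition face : finType := {f : {set bnd_arc} | f \in bcomps [set: edge]}.

Lemma bcomp_in a : bcomp [set: edge] a \in bcomps [set: edge].
Proof. exact: imset_f. Qed.

Definition face_of (a : bnd_arc) : face :=
  exist (fun f => f \in bcomps [set: edge]) _ (bcomp_in a).

(* The half-edge x of the dual graph lies in the face to the left of the       *)
(* half-edge x of G (looking away from the vertex), that is the face that      *)
(* contains the arc [inl x]; it crosses the edge of x.                         *)
Definition dual_vert (x : halfedge) : face := face_of (inl x).

(* A face lies to the right of the boundary of Sigma_G followed as above, so   *)
(* the counterclockwise order around the face is the inverse of that walk.     *)
Definition dual_rot : {perm halfedge} :=
  (rot G * perm (can_inj (crossK [set: edge])))^-1%g.

Lemma bnd_permT_inl k x :
  (bnd_perm [set: edge] ^+ k)%g (inl x) = inl ((dual_rot^-1 ^+ k)%g x).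
Proof.
elim: k => [|k IHk]; first by rewrite !expg0 !perm1.
by rewrite !expgSr !permM IHk permE /= /dual_rot invgK permM permE.
Qed.

Lemma dual_rot_vert x y :
  (dual_vert x == dual_vert y) = (y \in porbit dual_rot x).
Proof.
rewrite -val_eqE /= -porbitV eq_porbit_mem porbit_sym.
apply/porbitP/porbitP => -[k].
  by rewrite bnd_permT_inl => -[->]; exists k.
by move=> ->; exists k; rewrite bnd_permT_inl.
Qed.

Lemma face_gt0 : (0 < #|face|)%N.
Proof.
suff [a] : exists a : bnd_arc, True.
  by move=> _; apply/card_gt0P; exists (face_of a).
have /card_gt0P[v _] := vertex_gt0 G.
have [/codomP[x _]|vN] := boolP (v \in codom (@vert G)).
  by exists (inl x).
by exists (inr (exist _ v vN)).
Qed.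

Definition dual_graph : ribbonGraph := RibbonGraph dual_rot_vert face_gt0.

Definition has_loop : Prop := exists e : edge, vert (e, false) = vert (e, true).

Definition adj (v w : vertex G) : bool :=
  [exists x : halfedge, (vert x == v) && (vert (x.1, ~~ x.2) == w)].

Definition connected_graph : Prop := forall v w, connect adj v w.

(* Euler's formula V - E + F = 2 (c - g), where c is the number of connected   *)
(* components.  The difference below is even and never truncated.              *)
Definition genus : nat :=
  (((2 * n_comp adj predT + nedge G) - (#|vertex G| + #|face|))./2)%N.

End RibbonGraphTheory.

Definition adequate (G : ribbonGraph) : Prop :=
  ~ has_loop G /\ ~ has_loop (dual_graph G).

(* V has basis v_+ = true, v_- = false.  [mcoef a b c] is the coefficient of c *)
(* in m(a (x) b); [Deltacoef a b c] is that of b (x) c in Delta(a).            *)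
Definition mcoef (a b c : bool) : int :=
  match a, b, c with
  | true, true, true => 1
  | true, false, false => 1
  | false, true, false => 1
  | _, _, _ => 0
  end.

Definition Deltacoef (a b c : bool) : int :=
  match a, b, c with
  | true, true, false => 1
  | true, false, true => 1
  | false, false, false => 1
  | _, _, _ => 0
  end.

Section Khovanov.

Variable G : ribbonGraph.

(* The basis of CKh(G): a state is a vertex of the hypercube, seen as a set of *)
(* edges, and a basis vector of the tensor power of V over F(G(I)), encoded by *)
(* the set of the boundary components that carry v_+.                          *)
Definition state : finType :=
  {s : {set edge G} * {set {set bnd_arc G}} | s.2 \subset bcomps s.1}.

Definition sedges (s : state) : {set edge G} := (val s).1.
Definition splus (s : state) : {set {set bnd_arc G}} := (val s).2.

Definition hdeg (s : state) : int := #|sedges s|%:Z.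
Definition qdeg (s : state) : int :=
  #|splus s|%:Z - #|bcomps (sedges s) :\: splus s|%:Z + hdeg s.

(* Coefficient in d_xi of the hypercube edge xi from I to J = k |: I.  In      *)
(* G(I) the two ends of the band of e_k are glued to the components of the     *)
(* arcs (k, false) and (k, true); in G(J) these two arcs lie on the two sides  *)
(* of that band.                                                               *)
Definition dxi (k : edge G) (s t : state) : int :=
  let a := bcomp (sedges s) (inl (k, false)) in
  let b := bcomp (sedges s) (inl (k, true)) in
  let a' := bcomp (sedges t) (inl (k, false)) in
  let b' := bcomp (sedges t) (inl (k, true)) in
  if splus s :\: [set a; b] == splus t :\: [set a'; b'] then
    if a != b then mcoef (a \in splus s) (b \in splus s) (a' \in splus t)
    else Deltacoef (a \in splus s) (a' \in splus t) (b' \in splus t)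
  else 0.

Definition dcoef (s t : state) : int :=
  \sum_(k : edge G | (k \notin sedges s) && (sedges t == k |: sedges s))
    (-1) ^+ #|[set i in sedges s | (i < k)%N]| * dxi k s t.

Definition CKh : zmodType := {ffun state -> int}.

Definition kh_diff (c : CKh) : CKh := [ffun t => \sum_s c s * dcoef s t].

Lemma kh_diff_is_zmod_morphism : zmod_morphism kh_diff.
Proof.
move=> c c'; apply/ffunP => t; rewrite !ffunE -sumrB.
by apply: eq_bigr => s _; rewrite !ffunE mulrBl.
Qed.

HB.instance Definition _ :=
  GRing.isZmodMorphism.Build CKh CKh kh_diff
    kh_diff_is_zmod_morphism.

(* The marked point is given by the arc p that contains it.                    *)
Variable p : bnd_arc G.

Definition reduced_state (s : state) : bool :=
  bcomp (sedges s) p \notin splus s.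

Definition rCKh (i j : int) : {pred CKh} := fun c =>
  [forall s, (c s != 0) ==>
    [&& reduced_state s, hdeg s == i & qdeg s + 1 == j]].

Definition rcycle (i j : int) : {pred CKh} := fun c =>
  (c \in rCKh i j) && (kh_diff c == 0).

Lemma rCKh_closed i j : zmod_closed (rCKh i j).
Proof.
split=> [|c c' /forallP cP /forallP c'P]; apply/forallP => s.
  by rewrite ffunE eqxx.
have [c0|/(implyP (cP s)) sP] := eqVneq (c s) 0; last by rewrite sP implybT.
have [c'0|/(implyP (c'P s)) sP] := eqVneq (c' s) 0; last by rewrite sP implybT.
by rewrite !ffunE c0 c'0 subrr eqxx.
Qed.

HB.instance Definition _ i j :=
  GRing.isZmodClosed.Build CKh (rCKh i j) (rCKh_closed i j).

Lemma rcycle_closed i j : zmod_closed (rcycle i j).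
Proof.
split=> [|c c' /andP[cP /eqP dc] /andP[c'P /eqP dc']]; apply/andP.
  by rewrite rpred0 raddf0.
by rewrite rpredB // raddfB /= dc dc' subrr.
Qed.

HB.instance Definition _ i j :=
  GRing.isZmodClosed.Build CKh (rcycle i j) (rcycle_closed i j).

Record rcycles (i j : int) := RCycle {
  rcycle_val :> CKh;
  rcycleP : rcycle_val \in rcycle i j
}.

HB.instance Definition _ i j := [isSub for @rcycle_val i j].
HB.instance Definition _ i j := [Choice of rcycles i j by <:].
HB.instance Definition _ i j :=
  [SubChoice_isSubZmodule of rcycles i j by <:].

Definition rboundary (i j : int) : {pred rcycles i j} := fun z =>
  `[< exists2 c : CKh, c \in rCKh (i - 1) j & rcycle_val z = kh_diff c >].

Lemma rboundary_closed i j : zmod_closed (@rboundary i j).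
Proof.
split=> [|z z' /asboolP[c cP zc] /asboolP[c' c'P zc']]; apply/asboolP.
  by exists 0; rewrite ?rpred0 // raddf0.
by exists (c - c'); rewrite ?rpredB // (raddfB kh_diff) /= -zc -zc'.
Qed.

HB.instance Definition _ i j :=
  GRing.isZmodClosed.Build (rcycles i j) (@rboundary i j)
    (@rboundary_closed i j).

Definition rKh (i j : int) : zmodType :=
  Quotient.quot (@rboundary i j).

End Khovanov.

(* The summand of H in diagonal grading delta is nonzero.                      *)
Definition diag_nonzero (H : int -> int -> zmodType) (delta : rat) : Prop :=
  exists i j : int,
    delta = j%:~R / 2 - i%:~R /\ exists x : H i j, x != 0.

(* hw(H) = w; the maximum and the minimum are required to exist.               *)
Definition hw_eq (H : int -> int -> zmodType) (w : rat) : Prop :=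
  exists dmax dmin : rat,
    [/\ diag_nonzero H dmax, diag_nonzero H dmin,
        forall delta, diag_nonzero H delta -> dmin <= delta <= dmax
      & w = dmax - dmin + 1].

(* Main.v *)
Require Import Defs.
From mathcomp Require Import all_boot all_order all_algebra all_fingroup.
From mathcomp Require Import boolp zify ring lra.

(** Write V, E and F for the numbers of vertices, edges and faces.

    The extreme classes are explicit. The state without edges and with all labels
    v_- lies in diagonal grading (1 - V)/2, and the state with all edges and all
    unmarked labels v_+ lies in grading (F - 1 - E)/2. Adequacy says exactly that
    all bands are merges at the first state ([diag_max]) and splits into the
    second ([diag_min]), so that neither meets a nonzero coefficient of the
    differential. By Euler's formula the two gradings differ by the genus.

    It remains to see that the reduced homology of a connected graph lies between
    these gradings. Call Q a quasi-tree if it has one boundary component. The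
    claim ([rKh_quasitree]) is that the homology lives in the gradings -|Q|/2 of
    quasi-trees Q; toggling one edge changes the number of boundary components by
    one, whence V - 1 <= |Q| <= E + 1 - F ([quasitree_card]).

    The claim is proved by induction on subcubes ([marked_exact]), for complexes
    with several marked points, one on each boundary component of a vertex Q with
    the fewest components, where the labels at the marks are prescribed. Such a
    complex is a subquotient because labels only ever decrease along the
    differential. Follow the boundary from a mark to the first band e that is not
    yet decided. If the minimal number of components is attained on both halves of
    the cube, the long exact sequence ([exact_extension]) concludes. Otherwise e
    splits (or merges) at every vertex of the good half, and the split component
    can be given a new mark. Because e is adjacent to the old mark, the
    differential along e is then a bijection of basis states onto those with one
    label at the new mark, and these cancel ([exact_cancel]); the states with the
    other label form a marked subcube of smaller dimension, with the gradings of
    the good half.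

    Everything rests on the square of the differential being zero
    ([dcoef_square]). Instead of distinguishing the positions of two bands, pass to
    the deformation v_- * v_- = v_+. Its maps become diagonal when a state is
    evaluated at signs attached to the boundary components ([lee_ev]), and there
    commutation is a count of splits ([kappa_comm]). The deformed differential is
    the original one plus terms that raise the polynomial degree, so the identity
    descends ([dxi_comm]). *)

Set Implicit Arguments.
Unset Strict Implicit.
Unset Printing Implicit Defensive.

Import Order.TTheory GRing.Theory Num.Theory.
Local Open Scope ring_scope.

(** * Cycles of a permutation multiplied by a transposition *)

Section StableSets.

Variable T : finType.
Implicit Types (s : {perm T}) (X : {set T}).

Definition stable s X := [forall z, (s z \in X) == (z \in X)].

Lemma stableE s X z : stable s X -> (s z \in X) = (z \in X).
Proof. by move/forallP/(_ z)/eqP. Qed.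

Lemma stableX s X k z : stable s X -> ((s ^+ k)%g z \in X) = (z \in X).
Proof.
move=> sX; elim: k => [|k IHk]; first by rewrite expg0 perm1.
by rewrite expgSr permM stableE.
Qed.

Lemma stable_porbit s x : stable s (porbit s x).
Proof.
apply/forallP => z; rewrite porbit_sym [X in _ == X]porbit_sym.
by have := porbit_perm s 1 z; rewrite expg1 => ->.
Qed.

Lemma stableU s X Y : stable s X -> stable s Y -> stable s (X :|: Y).
Proof. by move=> sX sY; apply/forallP => z; rewrite !inE !stableE. Qed.

Lemma stable_mem s X x z : stable s X -> z \in porbit s x -> (z \in X) = (x \in X).
Proof. by move=> sX /porbitP[k ->]; rewrite stableX. Qed.

Lemma stable_sub s X x : stable s X -> (porbit s x \subset X) = (x \in X).
Proof.
move=> sX; apply/subsetP/idP => [-> //|xX z zx]; first exact: porbit_id.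
by rewrite (stable_mem sX zx).
Qed.

Lemma mem_porbits s c : c \in porbits s -> exists x, c = porbit s x.
Proof. by case/imsetP => x _ ->; exists x. Qed.

Lemma porbit_eq s x z : z \in porbit s x -> porbit s z = porbit s x.
Proof. by rewrite -eq_porbit_mem => /eqP. Qed.

Lemma porbits_eq s c z : c \in porbits s -> z \in c -> c = porbit s z.
Proof. by case/mem_porbits => x -> /porbit_eq. Qed.

End StableSets.

Section Transposition.

Variables (T : finType) (s : {perm T}) (x y : T).
Let s' := (s * tperm x y)%g.

Lemma mulg_tpermK : (s' * tperm x y)%g = s.
Proof. by rewrite /s' -mulgA tperm2 mulg1. Qed.

Lemma stable_mul_tperm (X : {set T}) : (x \in X) = (y \in X) -> stable s' X = stable s X.
Proof.
move=> xy; apply: eq_forallb => z; congr (_ == _).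
by rewrite /s' permM; case: tpermP => [->|->|//].
Qed.

Lemma porbit_mul_tpermU_sub :
  porbit s' x :|: porbit s' y \subset porbit s x :|: porbit s y.
Proof.
have st : stable s' (porbit s x :|: porbit s y).
  by rewrite stable_mul_tperm ?stableU ?stable_porbit // !inE !porbit_id orbT.
by rewrite subUset !(stable_sub _ st) !inE !porbit_id orbT.
Qed.

End Transposition.

Section TranspositionTheory.

Variables (T : finType) (s : {perm T}) (x y : T).
Let s' := (s * tperm x y)%g.

Lemma porbit_mul_tpermU :
  porbit s' x :|: porbit s' y = porbit s x :|: porbit s y.
Proof.
apply/eqP; rewrite eqEsubset porbit_mul_tpermU_sub -{1 2}(mulg_tpermK s x y).
exact: porbit_mul_tpermU_sub.
Qed.

Lemma card_porbits_mul_tperm :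
  (#|porbits s'| + (porbit s x != porbit s y).*2 = #|porbits s| + (x != y))%N.
Proof.
have -> : porbits s' = porbits (tperm x y * s^-1)%g.
  by rewrite -porbitsV /s' invMg tpermV.
by rewrite eq_porbit_mem -porbitV porbits_mul_tperm porbitsV.
Qed.

End TranspositionTheory.

Lemma porbit_mul_tperm_neq (T : finType) (s : {perm T}) (x y : T)
    (s' := (s * tperm x y)%g) : x != y ->
  (porbit s' x != porbit s' y) = (porbit s x == porbit s y).
Proof.
move=> neq_xy; have := card_porbits_mul_tperm s' x y; rewrite mulg_tpermK.
have := card_porbits_mul_tperm s x y; rewrite -/s' neq_xy.
case: (_ == _); case: (_ == _) => //=; lia.
Qed.

Lemma porbit_mul_tperm (T : finType) (s : {perm T}) (x y z : T) :
  porbit s z != porbit s x -> porbit s z != porbit s y ->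
  porbit (s * tperm x y)%g z = porbit s z.
Proof.
set s' := (s * tperm x y)%g => zx zy.
have sub (u v : {perm T}) : u = (v * tperm x y)%g ->
    z \notin porbit v x :|: porbit v y -> porbit u z \subset porbit v z.
  move=> -> zv; rewrite stable_sub ?porbit_id // stable_mul_tperm ?stable_porbit //.
  by move: zv; rewrite porbit_sym [y \in _]porbit_sym inE; do 2!case: (z \in _).
have zU : z \notin porbit s x :|: porbit s y by rewrite inE -!eq_porbit_mem negb_or zx.
apply/eqP; rewrite eqEsubset; apply/andP; split; apply: sub => //.
  by rewrite /s' mulg_tpermK.
by rewrite porbit_mul_tpermU.
Qed.

(** * Boundary components of spanning subgraphs *)

Section Boundary.

Variable G : ribbonGraph.
Implicit Types (T : {set edge G}) (e f : edge G) (x y : halfedge G) (a : bnd_arc G).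

Definition arc_at x : bnd_arc G := inl x.

Lemma arc_neq e : arc_at (e, false) != arc_at (e, true).
Proof. by apply/eqP => -[]. Qed.

Lemma bnd_permU1 T e : e \notin T ->
  bnd_perm (e |: T) = (bnd_perm T * tperm (arc_at (e, false)) (arc_at (e, true)))%g.
Proof.
move=> eT; apply/permP => -[x|v]; rewrite permM (permE (@bnd_next_inj G _)) (permE (@bnd_next_inj G _)) /=; last by rewrite tpermD.
rewrite /cross !inE; case: (Defs.rot G x) => f b /=.
have [->|fe] := eqVneq f e; first by rewrite (negPf eT) /=; case: b; rewrite ?tpermL ?tpermR.
by case: ifP => _; rewrite tpermD // /arc_at; apply: contra fe => /eqP[->].
Qed.

Lemma bcomp_id T a : a \in bcomp T a.
Proof. exact: porbit_id. Qed.

Lemma bcomp_eq T a b : (bcomp T a == bcomp T b) = (a \in bcomp T b).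
Proof. exact: eq_porbit_mem. Qed.

Lemma bcomp_in_bcomps T a : bcomp T a \in bcomps T.
Proof. exact: imset_f. Qed.

Lemma bcomps_eq T c z : c \in bcomps T -> z \in c -> c = bcomp T z.
Proof. exact: porbits_eq. Qed.

Definition ends T e : {set {set bnd_arc G}} :=
  [set bcomp T (arc_at (e, false)); bcomp T (arc_at (e, true))].

Definition joins T e := bcomp T (arc_at (e, false)) != bcomp T (arc_at (e, true)).

Lemma joinsU1 T e : e \notin T -> joins (e |: T) e = ~~ joins T e.
Proof.
by move=> eT; rewrite /joins /bcomp bnd_permU1 // porbit_mul_tperm_neq ?arc_neq // negbK.
Qed.

Lemma bcompU1 T e : e \notin T ->
  bcomp (e |: T) (arc_at (e, false)) :|: bcomp (e |: T) (arc_at (e, true)) =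
  bcomp T (arc_at (e, false)) :|: bcomp T (arc_at (e, true)).
Proof. by move=> eT; rewrite /bcomp bnd_permU1 // porbit_mul_tpermU. Qed.

Lemma bcompU1_other T e a : e \notin T -> bcomp T a \notin ends T e ->
  bcomp (e |: T) a = bcomp T a.
Proof.
rewrite !inE negb_or => eT /andP[a0 a1].
by rewrite /bcomp bnd_permU1 // porbit_mul_tperm.
Qed.

Lemma ends_mem T e a : (bcomp T a \in ends T e) =
  (a \in bcomp T (arc_at (e, false)) :|: bcomp T (arc_at (e, true))).
Proof. by rewrite !inE !bcomp_eq. Qed.

Lemma ends_memU1 T e a : e \notin T ->
  (bcomp (e |: T) a \in ends (e |: T) e) = (bcomp T a \in ends T e).
Proof. by move=> eT; rewrite !ends_mem bcompU1. Qed.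

Lemma bcompsU1 T e : e \notin T ->
  bcomps (e |: T) :\: ends (e |: T) e = bcomps T :\: ends T e.
Proof.
move=> eT; apply/setP => c; rewrite !in_setD; apply/andP/andP => -[ce /mem_porbits[a ca]].
  have aN : bcomp T a \notin ends T e by rewrite -ends_memU1 // -[bcomp _ _]ca.
  have -> : c = bcomp T a by rewrite ca -[porbit _ _]/(bcomp _ _) bcompU1_other.
  by rewrite aN bcomp_in_bcomps.
have aN : bcomp T a \notin ends T e by rewrite -[bcomp _ _]ca.
have -> : c = bcomp (e |: T) a by rewrite ca bcompU1_other.
by rewrite ends_memU1 // aN bcomp_in_bcomps.
Qed.

Lemma card_bcompsU1 T e : e \notin T ->
  (#|bcomps (e |: T)| + (joins T e).*2 = #|bcomps T| + 1)%N.
Proof.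
by move=> eT; rewrite /bcomps bnd_permU1 // card_porbits_mul_tperm arc_neq.
Qed.

Lemma bcomps_gt0 T : (0 < #|bcomps T|)%N.
Proof.
by have [f _] := card_gt0P (face_gt0 G); case: f => f /mem_porbits[a _];
   apply/card_gt0P; exists (bcomp T a); apply: bcomp_in_bcomps.
Qed.

End Boundary.

(** * States and their labels *)

Section States.

Variable G : ribbonGraph.
Implicit Types (T : {set edge G}) (e f : edge G) (a : bnd_arc G) (s t u : state G).
Implicit Types (P : {set {set bnd_arc G}}) (X : {set bnd_arc G}).

Lemma splus_sub s : splus s \subset bcomps (sedges s).
Proof. exact: valP s. Qed.

Lemma state_eq s t : sedges s = sedges t -> splus s = splus t -> s = t.
Proof.
move=> eT eP; apply: val_inj; move: eT eP; rewrite /sedges /splus.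
by case: (val s) (val t) => [? ?] [? ?] /= -> ->.
Qed.

Lemma mkstate_subproof T P : (T, P :&: bcomps T).2 \subset bcomps (T, P :&: bcomps T).1.
Proof. exact: subsetIr. Qed.

Definition mkstate T P : state G :=
  exist (fun s : {set edge G} * {set {set bnd_arc G}} => s.2 \subset bcomps s.1)
    (T, P :&: bcomps T) (mkstate_subproof T P).

Lemma sedges_mk T P : sedges (mkstate T P) = T. Proof. by []. Qed.

Lemma splus_mk T P : splus (mkstate T P) = P :&: bcomps T. Proof. by []. Qed.

(** [true] stands for v_+ and [false] for v_-. *)
Definition label s a : bool := bcomp (sedges s) a \in splus s.

Lemma label_mk T P a : label (mkstate T P) a = (bcomp T a \in P).
Proof. by rewrite /label splus_mk inE bcomp_in_bcomps andbT. Qed.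

Lemma label_bcomp s a b : a \in bcomp (sedges s) b -> label s a = label s b.
Proof. by rewrite -bcomp_eq /label => /eqP ->. Qed.

Definition same_away e s t :=
  splus s :\: ends (sedges s) e == splus t :\: ends (sedges t) e.

Lemma dxiE e s t : dxi e s t =
  if same_away e s t then
    if joins (sedges s) e
    then mcoef (label s (arc_at (e, false))) (label s (arc_at (e, true))) (label t (arc_at (e, false)))
    else Deltacoef (label s (arc_at (e, false))) (label t (arc_at (e, false))) (label t (arc_at (e, true)))
  else 0.
Proof. by []. Qed.

(** When both ends of the band lie on one component this is meaningful only for
    [l0 = l1]. *)
Definition relabel T e P l0 l1 : state G :=
  mkstate T (P :\: ends T e :|:
    [set c in ends T e | (c == bcomp T (arc_at (e, false))) && l0
                         || (c == bcomp T (arc_at (e, true))) && l1]).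

Lemma relabel_away T e P l0 l1 : P :\: ends T e \subset bcomps T ->
  splus (relabel T e P l0 l1) :\: ends T e = P :\: ends T e.
Proof.
move=> PT; rewrite splus_mk; apply/setP => c; move/subsetP: PT => /(_ c).
rewrite !in_set.
by case: (_ || _) => //=; case: (c \in P) => // ->.
Qed.

Lemma relabel0 T e P l0 l1 : joins T e || (l0 == l1) ->
  label (relabel T e P l0 l1) (arc_at (e, false)) = l0.
Proof.
rewrite label_mk in_setU in_setD !inE !eqxx /= /joins.
by case: (_ == _) => //=; case: l0 l1 => -[].
Qed.

Lemma relabel1 T e P l0 l1 : joins T e || (l0 == l1) ->
  label (relabel T e P l0 l1) (arc_at (e, true)) = l1.
Proof.
rewrite label_mk in_setU in_setD !inE !eqxx orbT /= /joins eq_sym.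
by case: (_ == _) => //=; case: l0 l1 => -[].
Qed.

Lemma relabelK T e P s : sedges s = T -> splus s :\: ends T e = P :\: ends T e ->
  s = relabel T e P (label s (arc_at (e, false))) (label s (arc_at (e, true))).
Proof.
move=> sT sP; apply: state_eq; first by rewrite sedges_mk.
rewrite splus_mk; apply/setP => c; move/setP/(_ c): sP; rewrite !(in_set, in_set1) /label sT.
have cT : c \in splus s -> c \in bcomps T by rewrite -sT; apply/subsetP/splus_sub.
case: eqP => [->|_] /=; rewrite ?bcomp_in_bcomps.
  by case: eqP => [->|_] _; rewrite ?eqxx ?orbb ?orbF ?andbT.
case: eqP => [->|_] /=; rewrite ?bcomp_in_bcomps ?andbT // => <-.
by case: (c \in splus s) cT => // ->.
Qed.

Lemma sum_relabel_split T e P (F : state G -> int) : joins T e ->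
    P :\: ends T e \subset bcomps T ->
    (forall s, F s != 0 -> sedges s = T /\ splus s :\: ends T e = P :\: ends T e) ->
  \sum_s F s = F (relabel T e P true true) + F (relabel T e P true false)
             + F (relabel T e P false true) + F (relabel T e P false false).
Proof.
move=> jT PT F0.
rewrite (partition_big (fun s => (label s (arc_at (e, false)), label s (arc_at (e, true)))) predT) //=.
have E (p : bool * bool) : \sum_(s | (label s (arc_at (e, false)), label s (arc_at (e, true))) == p) F s
    = F (relabel T e P p.1 p.2).
  rewrite (bigD1 (relabel T e P p.1 p.2)) /=; last first.
    by rewrite relabel0 ?relabel1 ?jT //; case: p.
  rewrite big1 ?addr0 // => s /andP[/eqP <- /=].
  apply: contraNeq => /F0[sT sP]; by rewrite eq_sym -relabelK.
rewrite (eq_bigr _ (fun p _ => E p)).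
rewrite -(pair_big predT predT (fun i j => F (relabel T e P i j))) /=.
by rewrite !big_bool /= addrA.
Qed.

Lemma sum_relabel_merge T e P (F : state G -> int) : ~~ joins T e ->
    P :\: ends T e \subset bcomps T ->
    (forall s, F s != 0 -> sedges s = T /\ splus s :\: ends T e = P :\: ends T e) ->
  \sum_s F s = F (relabel T e P true true) + F (relabel T e P false false).
Proof.
move=> jT PT F0.
have e01 s : sedges s = T -> label s (arc_at (e, true)) = label s (arc_at (e, false)).
  by move=> sT; move: jT; rewrite /joins negbK /label sT => /eqP ->.
rewrite (partition_big (fun s => label s (arc_at (e, false))) predT) //=.
have E (p : bool) : \sum_(s | label s (arc_at (e, false)) == p) F s = F (relabel T e P p p).
  rewrite (bigD1 (relabel T e P p p)) /=; last first.
    by rewrite relabel0 ?eqxx ?orbT.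
  rewrite big1 ?addr0 // => s /andP[/eqP <- /=].
  apply: contraNeq => /F0[sT sP]; by rewrite eq_sym -{2}(e01 s) // -relabelK.
by rewrite (eq_bigr _ (fun p _ => E p)) big_bool.
Qed.

End States.

(** * The square of the differential *)

Section Lee.

Variable G : ribbonGraph.
Implicit Types (T : {set edge G}) (e f : edge G) (a : bnd_arc G) (s t u : state G).
Implicit Types (P : {set {set bnd_arc G}}) (X c : {set bnd_arc G}).

(** The deformation of Lee. With v_- * v_- = v_+ and
    Delta v_- = v_- (x) v_- + v_+ (x) v_+ the multiplication becomes that of
    the group ring of a group of order two, and every structure constant is
    the indicator of a parity condition on labels. *)
Definition leexi e s t : int :=
  if same_away e s t then
    if joins (sedges s) e
    then (label t (arc_at (e, false)) ==
           (label s (arc_at (e, false)) == label s (arc_at (e, true))))%:R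
    else (label s (arc_at (e, false)) ==
           (label t (arc_at (e, false)) != label t (arc_at (e, true))))%:R
  else 0.

Definition sgn (b : bool) : int := if b then -1 else 1.

Definition weight P X c : int := if c \in P then 1 else sgn (c \subset X).

(** A stable set [X] of arcs is a choice of a sign for each boundary component;
    [ev X s] is the value at these signs of the monomial of [s], where v_-
    stands for the variable of its component. *)
Definition ev X s : int :=
  if stable (bnd_perm (sedges s)) X
  then \prod_(c in bcomps (sedges s)) weight (splus s) X c else 0.

Definition rest T e P X : int := \prod_(c in bcomps T :\: ends T e) weight P X c.

Lemma weight_bcomp P X T a : stable (bnd_perm T) X ->
  weight P X (bcomp T a) = if bcomp T a \in P then 1 else sgn (a \in X).
Proof. by move=> TX; rewrite /weight stable_sub. Qed.

Lemma ends_sub T e : ends T e \subset bcomps T.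
Proof. by apply/subsetP => c; rewrite !inE => /orP[] /eqP ->; apply: bcomp_in_bcomps. Qed.

Lemma ev_rest X s e : stable (bnd_perm (sedges s)) X ->
  ev X s = rest (sedges s) e (splus s) X *
    ((if label s (arc_at (e, false)) then 1 else sgn (arc_at (e, false) \in X)) *
     (if ~~ joins (sedges s) e || label s (arc_at (e, true)) then 1
      else sgn (arc_at (e, true) \in X))).
Proof.
move=> sX; rewrite /ev sX (big_setID (ends (sedges s) e)) /= mulrC.
rewrite (setIidPr (ends_sub _ _)) -/(rest _ _ _ _); congr (_ * _).
rewrite /joins /ends; have [<-|ne] := eqVneq.
  by rewrite setUid big_set1 weight_bcomp // mulr1.
by rewrite big_setU1 ?inE // big_set1 !weight_bcomp.
Qed.

Lemma rest_away T e s P X : e \notin T ->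
  splus s :\: ends (e |: T) e = P :\: ends T e ->
  rest (e |: T) e (splus s) X = rest T e P X.
Proof.
move=> eT sP; rewrite /rest bcompsU1 //; apply: eq_bigr => c; rewrite in_setD => /andP[cN cT].
have cN' : c \notin ends (e |: T) e.
  have : c \in bcomps T :\: ends T e by rewrite in_setD cN.
  by rewrite -bcompsU1 // in_setD => /andP[].
by rewrite /weight; move/setP/(_ c): sP; rewrite !in_setD cN cN' /= => ->.
Qed.

(** The eigenvalue of the deformed map along [e] at the signs [X]: a merge
    evaluates to the identity, and a split multiplies by the sum of the two
    signs, which cancels unless they agree. *)
Definition kappa X T e : int :=
  if stable (bnd_perm (e |: T)) X
  then if joins T e then 1 else 2 * sgn (arc_at (e, false) \in X)
  else 0.

Lemma stable_ends T e X : e \notin T ->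
  (arc_at (e, false) \in X) = (arc_at (e, true) \in X) ->
  stable (bnd_perm (e |: T)) X = stable (bnd_perm T) X.
Proof. by move=> eT eX; rewrite bnd_permU1 // stable_mul_tperm. Qed.

Lemma stable_bcomp T X a b : stable (bnd_perm T) X -> bcomp T a = bcomp T b ->
  (a \in X) = (b \in X).
Proof. by move=> TX /eqP; rewrite bcomp_eq => /(stable_mem TX). Qed.

(** The components of [T] and of [e |: T] together connect the two ends of the
    band of [e]. *)
Lemma stable_endsE T e X : e \notin T -> stable (bnd_perm T) X ->
  stable (bnd_perm (e |: T)) X = ((arc_at (e, false) \in X) == (arc_at (e, true) \in X)).
Proof.
move=> eT TX; have [eX|eX] := eqVneq; first by rewrite stable_ends.
apply: contraNF eX => T'X; case jT : (joins T e).
  apply/eqP/(stable_bcomp T'X)/eqP; apply: negbNE.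
  by rewrite -/(joins _ _) joinsU1 // jT.
by apply/eqP/(stable_bcomp TX)/eqP; rewrite -[_ == _]negbK -/(joins _ _) jT.
Qed.

Lemma same_away_sub s e : e \notin sedges s ->
  splus s :\: ends (sedges s) e \subset bcomps (e |: sedges s).
Proof.
move=> es; apply: (subset_trans (setSD _ (splus_sub s))).
by rewrite -bcompsU1 // subsetDl.
Qed.

Definition target e s l0 l1 : state G :=
  relabel (e |: sedges s) e (splus s :\: ends (sedges s) e) l0 l1.

Lemma away_ends e s : e \notin sedges s ->
  (splus s :\: ends (sedges s) e) :\: ends (e |: sedges s) e =
  splus s :\: ends (sedges s) e.
Proof.
move=> es; apply/setDidPl; rewrite disjoint_sym disjoints_subset.
apply/subsetP => c ce; rewrite inE; apply: contraL ce.
move/(subsetP (setSD _ (splus_sub s))).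
by rewrite -bcompsU1 // in_setD => /andP[].
Qed.

Lemma target_away e s l0 l1 : e \notin sedges s ->
  splus (target e s l0 l1) :\: ends (e |: sedges s) e =
  splus s :\: ends (sedges s) e.
Proof.
by move=> es; rewrite relabel_away away_ends // same_away_sub.
Qed.

Lemma target_same e s l0 l1 : e \notin sedges s -> same_away e s (target e s l0 l1).
Proof. by move=> es; rewrite /same_away target_away. Qed.

Lemma sum_target e s (F : state G -> int) : e \notin sedges s ->
    (forall t, F t != 0 -> sedges t = e |: sedges s /\ same_away e s t) ->
  \sum_t F t = if joins (sedges s) e
    then F (target e s true true) + F (target e s false false)
    else F (target e s true true) + F (target e s true false)
       + F (target e s false true) + F (target e s false false).
Proof.
move=> es F0; have sD := away_ends es.
have F1 t : F t != 0 -> sedges t = e |: sedges s /\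
    splus t :\: ends (e |: sedges s) e =
    (splus s :\: ends (sedges s) e) :\: ends (e |: sedges s) e.
  by case/F0 => te /eqP; rewrite te sD => ->.
have j' := joinsU1 es; case: ifP j' => jT j'.
  by apply: sum_relabel_merge => //; rewrite ?j' // sD same_away_sub.
by apply: sum_relabel_split => //; rewrite ?j' // sD same_away_sub.
Qed.

(** Evaluation at signs diagonalizes the deformed map. One state
    contributes when [e] merges, and two when it splits. *)
Lemma lee_ev X e s : e \notin sedges s ->
  \sum_(t | sedges t == e |: sedges s) leexi e s t * ev X t =
  kappa X (sedges s) e * ev X s.
Proof.
move=> es; rewrite big_mkcond /= (sum_target es); last first.
  move=> t; have [te|_] := eqVneq (sedges t) (e |: sedges s); last by rewrite eqxx.
  by rewrite /leexi; case: (same_away e s t) => /=; rewrite ?mul0r ?eqxx.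
rewrite !sedges_mk eqxx /kappa.
have [T'X|T'X] := boolP (stable _ _); last first.
  by rewrite /ev !sedges_mk (negPf T'X) !mulr0 !addr0 mul0r; case: ifP.
have E l0 l1 : joins (sedges s) e ==> (l0 == l1) ->
  leexi e s (target e s l0 l1) * ev X (target e s l0 l1) =
  rest (sedges s) e (splus s) X *
    ((if joins (sedges s) e
     then (l0 == (label s (arc_at (e, false)) == label s (arc_at (e, true))))%:R
     else (label s (arc_at (e, false)) == (l0 != l1))%:R) *
    ((if l0 then 1 else sgn (arc_at (e, false) \in X)) *
     (if joins (sedges s) e || l1 then 1 else sgn (arc_at (e, true) \in X)))).
  move=> jl; rewrite (ev_rest e) ?sedges_mk // /leexi target_same //.
  have j' : joins (e |: sedges s) e || (l0 == l1) by rewrite joinsU1 // -implybE.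
  rewrite (rest_away _ es (target_away _ _ es)) relabel0 // relabel1 // joinsU1 // negbK.
  by rewrite mulrCA.
have sX : stable (bnd_perm (sedges s)) X ->
    (arc_at (e, false) \in X) = (arc_at (e, true) \in X).
  by move=> sX; apply/eqP; rewrite -(stable_endsE es).
have jX : joins (sedges s) e -> (arc_at (e, false) \in X) = (arc_at (e, true) \in X).
  move=> jT; apply/(stable_bcomp T'X)/eqP/negbNE.
  by rewrite -/(joins _ _) joinsU1 // jT.
have [sX1|sX'] := boolP (stable (bnd_perm (sedges s)) X); last first.
  have eX : (arc_at (e, false) \in X) != (arc_at (e, true) \in X).
    by apply: contra sX' => /eqP eX; rewrite -(stable_ends es).
  case jT : (joins _ _); first by move: eX; rewrite (jX jT) eqxx.
  rewrite !E jT // [ev X s]/ev (negPf sX') mulr0 -!mulrDr.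
  rewrite /sgn; case: (label _ _); case: (_ \in X) eX; case: (_ \in X) => //= _;
  ring.
rewrite [ev X s](ev_rest e) //.
case jT : (joins _ _); rewrite !E jT //= /sgn (sX sX1);
by case: (label s (arc_at (e, false))); case: (label s (arc_at (e, true)));
  case: (_ \in X) => //=; ring.
Qed.

End Lee.

(** The number of components at the far corner of a square does not depend on
    the path, hence neither does the number of merges along it. *)
Lemma square_count (j1 j2 j3 j4 : bool) (n n1 n2 n3 : nat) :
  (n1 + j1.*2 = n + 1 -> n2 + j2.*2 = n + 1 -> n3 + j3.*2 = n1 + 1 ->
   n3 + j4.*2 = n2 + 1 -> j1 + j3 = j2 + j4)%N.
Proof. by case: j1 j2 j3 j4 => [] [] [] [] /=; lia. Qed.

Section DifferentialSquare.

Variable G : ribbonGraph.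
Implicit Types (T : {set edge G}) (e f : edge G) (a : bnd_arc G) (s t u : state G).
Implicit Types (P J : {set {set bnd_arc G}}) (X c : {set bnd_arc G}).

(** If toggling [e] changes whether [f] merges or splits, then [f] meets a
    component that [e] meets, so that their signs agree. *)
Lemma joins_other T e f X : e \notin T ->
    stable (bnd_perm T) X -> stable (bnd_perm (e |: T)) X ->
    joins T f != joins (e |: T) f ->
  (arc_at (f, false) \in X) = (arc_at (e, false) \in X).
Proof.
move=> eT TX T'X jf.
have eX : (arc_at (e, false) \in X) = (arc_at (e, true) \in X).
  by apply/eqP; rewrite -(stable_endsE eT).
have endsX a : bcomp T a \in ends T e -> (a \in X) = (arc_at (e, false) \in X).
  by rewrite !inE => /orP[]/eqP/(stable_bcomp TX); rewrite -?eX.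
have [/endsX //|f0] := boolP (bcomp T (arc_at (f, false)) \in ends T e).
have [/endsX <-|f1] := boolP (bcomp T (arc_at (f, true)) \in ends T e); last first.
  by move: jf; rewrite /joins !bcompU1_other // eqxx.
have [jT|] := boolP (joins T f).
  by move: jf; rewrite jT eq_sym eqb_id negbK => /eqP/(stable_bcomp T'X).
by rewrite /joins negbK => /eqP/(stable_bcomp TX).
Qed.

(** Both orders involve equally many splits. A factor can only pass from [e] to
    [f] if toggling one band changes the nature of the other, and then the two
    signs are equal. *)
Lemma kappa_comm X T e f : e != f -> e \notin T -> f \notin T ->
    stable (bnd_perm T) X ->
  kappa X (e |: T) f * kappa X T e = kappa X (f |: T) e * kappa X T f.
Proof.
move=> ef eT fT TX; have eT' : e \notin f |: T by rewrite !inE negb_or ef.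
have fT' : f \notin e |: T by rewrite !inE negb_or eq_sym ef.
have Te := stable_endsE eT TX; have Tf := stable_endsE fT TX.
rewrite /kappa; case TeX : (stable (bnd_perm (e |: T)) X); last first.
  rewrite mulr0; case TfX : (stable (bnd_perm (f |: T)) X); last by rewrite mulr0.
  by rewrite (stable_endsE eT' TfX) -Te TeX mul0r.
case TfX : (stable (bnd_perm (f |: T)) X); last first.
  by rewrite mulr0 (stable_endsE fT' TeX) -Tf TfX mul0r.
rewrite (stable_endsE eT' TfX) (stable_endsE fT' TeX) -Te -Tf TeX TfX.
have cnt : (joins T e + joins (e |: T) f = joins T f + joins (f |: T) e)%N.
  have H := card_bcompsU1 fT'; rewrite (setUCA [set f] [set e] T) in H.
  exact: square_count (card_bcompsU1 eT) (card_bcompsU1 fT) H (card_bcompsU1 eT').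
have := joins_other eT TX TeX (f := f).
case: (joins T e) cnt; case: (joins T f); case: (joins (e |: T) f);
  case: (joins (f |: T) e) => //= cnt H; first [by move/eqP: cnt | by rewrite H //; ring | ring].
Qed.

Lemma mem_cover_bcomps T J a : J \subset bcomps T ->
  (a \in cover J) = (bcomp T a \in J).
Proof.
move=> /subsetP JT; apply/bigcupP/idP => [[c cJ ac]|aJ].
  by rewrite -(bcomps_eq (JT c cJ) ac).
by exists (bcomp T a); rewrite ?bcomp_id.
Qed.

Lemma stable_cover T J : J \subset bcomps T -> stable (bnd_perm T) (cover J).
Proof.
move=> JT; apply/forallP => a; rewrite !(mem_cover_bcomps _ JT).
by have := porbit_perm (bnd_perm T) 1 a; rewrite expg1 /bcomp => ->.
Qed.

Lemma ev_cover s J : J \subset bcomps (sedges s) ->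
  ev (cover J) s =
  \prod_(c in bcomps (sedges s)) if c \in J then sgn (c \notin splus s) else 1.
Proof.
move=> JT; rewrite /ev stable_cover //; apply: eq_bigr => c /mem_porbits[a ->].
rewrite weight_bcomp ?stable_cover // (mem_cover_bcomps _ JT) -/(bcomp _ _).
by rewrite /sgn; case: (_ \in splus s) => /=; case: (_ \in J).
Qed.

(** Orthogonality of the characters of a power of the group of order two: [J]
    runs over the characters and the states over [T] are the group elements. *)
Lemma ev_orthogonal T s t : sedges s = T -> sedges t = T ->
  \sum_(J : {set {set bnd_arc G}} | J \subset bcomps T) ev (cover J) s * ev (cover J) t =
  if s == t then 2 ^+ #|bcomps T| else 0.
Proof.
move=> sT tT; pose g c := sgn (c \notin splus s) * sgn (c \notin splus t).
transitivity (\prod_c ((if c \in bcomps T then g c else 0) + 1)).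
  rewrite bigA_distr [RHS](bigID (fun J : {set {set bnd_arc G}} => J \subset bcomps T)) /=.
  rewrite [X in _ = _ + X]big1 ?addr0 => [|J /subsetPn[c cJ cT]]; last first.
    by rewrite (bigD1 c) //= cJ (negPf cT) mul0r.
  apply: eq_bigr => J JT; rewrite !ev_cover ?sT ?tT // -big_split /=.
  rewrite big_mkcond /=; apply: eq_bigr => c _.
  have [cT|cN] := ifP; first by case: ifP; rewrite ?mulr1.
  by case: ifP => // /(subsetP JT); rewrite cN.
have [st|st] := eqVneq s t.
  rewrite -prodr_const [RHS]big_mkcond /=; apply: eq_bigr => c _; rewrite /g -st.
  by case: ifP => // _; case: (c \in splus s).
have [c cP] : exists c, (c \in splus s) != (c \in splus t).
  apply/existsP; rewrite -negb_forall; apply: contra st => /forallP st.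
  by apply/eqP/state_eq; rewrite ?sT //; apply/setP => c; apply/eqP.
have cT : c \in bcomps T.
  move: cP; have := subsetP (splus_sub s) c; have := subsetP (splus_sub t) c.
  rewrite sT tT; case: (c \in splus s) => [_ /(_ isT) -> //|].
  by case: (c \in splus t) => [/(_ isT) ->|].
rewrite (bigD1 c) //= cT /g; case: (c \in splus s) cP; case: (c \in splus t) => //= _;
by rewrite /sgn ?mulr1 ?mul1r addNr mul0r.
Qed.

Lemma ev_inj T (x : state G -> int) :
    (forall X, \sum_(s | sedges s == T) x s * ev X s = 0) ->
  forall s, sedges s = T -> x s = 0.
Proof.
move=> x0 s sT; have : x s * 2 ^+ #|bcomps T| = 0.
  transitivity (\sum_(J : {set {set bnd_arc G}} | J \subset bcomps T)
     (\sum_(t | sedges t == T) x t * ev (cover J) t) * ev (cover J) s); last first.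
    by rewrite big1 // => J _; rewrite x0 mul0r.
  under eq_bigr do rewrite mulr_suml.
  rewrite exchange_big (bigD1 s) /= ?sT // [X in _ + X]big1 => [|t /andP[/eqP tT ts]].
    by under eq_bigr do rewrite -mulrA; rewrite -mulr_sumr ev_orthogonal // eqxx addr0.
  by under eq_bigr do rewrite -mulrA; rewrite -mulr_sumr ev_orthogonal // (negPf ts) mulr0.
by move/eqP; rewrite mulf_eq0 expf_eq0 andbF orbF => /eqP.
Qed.

Lemma lee_comm e f s u : e != f -> e \notin sedges s -> f \notin sedges s ->
    sedges u = f |: (e |: sedges s) ->
  \sum_(t | sedges t == e |: sedges s) leexi e s t * leexi f t u =
  \sum_(t | sedges t == f |: sedges s) leexi f s t * leexi e t u.
Proof.
move=> ef es fs uT; apply/eqP; rewrite -subr_eq0; apply/eqP; move: u uT.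
apply: ev_inj => X.
have E e' f' : e' \notin sedges s -> f' \notin e' |: sedges s ->
    \sum_(u | sedges u == f' |: (e' |: sedges s))
      (\sum_(t | sedges t == e' |: sedges s) leexi e' s t * leexi f' t u) * ev X u =
    kappa X (e' |: sedges s) f' * kappa X (sedges s) e' * ev X s.
  move=> es' fs'; under eq_bigr do rewrite mulr_suml.
  rewrite exchange_big -mulrA -lee_ev // mulr_sumr; apply: eq_bigr => t /= /eqP tT.
  under eq_bigr do rewrite -mulrA; rewrite -mulr_sumr -tT lee_ev ?tT //; ring.
under eq_bigr do rewrite mulrBl; rewrite sumrB E //; last first.
  by rewrite !inE negb_or eq_sym ef.
rewrite setUCA E //; last by rewrite !inE negb_or ef.
have [sX|sX] := boolP (stable (bnd_perm (sedges s)) X); first by rewrite kappa_comm ?subrr.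
by rewrite /ev (negPf sX) !mulr0 subrr.
Qed.

Lemma qdeg_sum s : qdeg s = \sum_(c in bcomps (sedges s)) sgn (c \notin splus s) + hdeg s.
Proof.
rewrite /qdeg (big_setID (splus s)) /= (setIidPr (splus_sub s)).
rewrite (eq_bigr (fun=> 1)) => [|c ->]; last by [].
rewrite [X in _ = _ + X + _](eq_bigr (fun=> -1)) => [|c]; last first.
  by rewrite in_setD => /andP[-> _].
by rewrite !sumr_const mulNrn !natz.
Qed.

Lemma qdeg_ends e s : qdeg s =
  \sum_(c in bcomps (sedges s) :\: ends (sedges s) e) sgn (c \notin splus s) + hdeg s +
  (sgn (~~ label s (arc_at (e, false))) +
   (if joins (sedges s) e then sgn (~~ label s (arc_at (e, true))) else 0)).
Proof.
rewrite qdeg_sum (big_setID (ends (sedges s) e)) /= (setIidPr (ends_sub _ _)).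
rewrite -addrA addrC; congr (_ + _).
rewrite /joins /ends; have [<-|ne] := eqVneq; first by rewrite setUid big_set1 addr0.
by rewrite big_setU1 ?inE // big_set1.
Qed.

Lemma hdegU1 e s t : e \notin sedges s -> sedges t = e |: sedges s -> hdeg t = hdeg s + 1.
Proof. by move=> es te; rewrite /hdeg te cardsU1 es PoszD addrC. Qed.

Lemma qdegU1 e s t : e \notin sedges s -> sedges t = e |: sedges s -> same_away e s t ->
  qdeg t - qdeg s = 1 +
   (sgn (~~ label t (arc_at (e, false))) +
    (if joins (sedges s) e then 0 else sgn (~~ label t (arc_at (e, true))))) -
   (sgn (~~ label s (arc_at (e, false))) +
    (if joins (sedges s) e then sgn (~~ label s (arc_at (e, true))) else 0)).
Proof.
move=> es te sa; rewrite !(qdeg_ends e) (hdegU1 es te) te joinsU1 // bcompsU1 //.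
have -> : \sum_(c in bcomps (sedges s) :\: ends (sedges s) e) sgn (c \notin splus t) =
          \sum_(c in bcomps (sedges s) :\: ends (sedges s) e) sgn (c \notin splus s).
  apply: eq_bigr => c cT; have : c \in bcomps (e |: sedges s) :\: ends (e |: sedges s) e.
    by rewrite bcompsU1.
  rewrite in_setD => /andP[cN _]; move: cT; rewrite in_setD => /andP[cN' _].
  by move/eqP/setP/(_ c): sa; rewrite te !in_setD cN cN' /= => ->.
by case: (joins _ _) => /=; ring.
Qed.

(** The two terms that the deformation adds raise the polynomial degree by 4. *)
Lemma leexi_qdeg e s t : e \notin sedges s -> sedges t = e |: sedges s ->
  leexi e s t != 0 -> qdeg s <= qdeg t.
Proof.
move=> es te; rewrite /leexi; case: ifP => // /(qdegU1 es te); rewrite -subr_ge0 => ->.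
by case: (joins _ _); do 3!case: (label _ _).
Qed.

Lemma dxi_leexi e s t : e \notin sedges s -> sedges t = e |: sedges s ->
  dxi e s t = if qdeg t == qdeg s then leexi e s t else 0.
Proof.
move=> es te; rewrite dxiE /leexi; case: ifP => [/(qdegU1 es te)|_]; last by case: ifP.
rewrite -subr_eq0 => ->.
by case: (joins _ _); do 3!case: (label _ _).
Qed.

(** The undeformed composite is the part of the deformed one that preserves the
    polynomial degree. *)
Lemma dxi_comm e f s u : e != f -> e \notin sedges s -> f \notin sedges s ->
    sedges u = f |: (e |: sedges s) ->
  \sum_(t | sedges t == e |: sedges s) dxi e s t * dxi f t u =
  \sum_(t | sedges t == f |: sedges s) dxi f s t * dxi e t u.
Proof.
move=> ef es fs uT.
have E e' f' : e' \notin sedges s -> f' \notin e' |: sedges s ->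
    sedges u = f' |: (e' |: sedges s) ->
    \sum_(t | sedges t == e' |: sedges s) dxi e' s t * dxi f' t u =
    if qdeg u == qdeg s then
      \sum_(t | sedges t == e' |: sedges s) leexi e' s t * leexi f' t u else 0.
  move=> es' fs' uT'; case: ifP => [/eqP us|us].
    apply: eq_bigr => t /eqP tT.
    rewrite !dxi_leexi ?tT // us eq_sym; case: eqP => [//|ts]; rewrite ?mul0r.
    apply/esym/eqP; apply: contra_notT ts; rewrite mulf_eq0 negb_or => /andP[l1 l2].
    apply/eqP; rewrite eq_le (leexi_qdeg _ _ l1) // -us (leexi_qdeg _ _ l2) ?tT //.
  rewrite big1 // => t /eqP tT; rewrite !dxi_leexi ?tT //.
  case: eqP => [->|_]; last by rewrite mul0r.
  by rewrite us mulr0.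
have fe : f \notin e |: sedges s by rewrite !inE negb_or eq_sym ef.
have ef' : e \notin f |: sedges s by rewrite !inE negb_or ef.
have uT' : sedges u = e |: (f |: sedges s) by rewrite uT (setUCA [set f]).
by rewrite (E e f es fe uT) (E f e fs ef' uT') (lee_comm ef es fs uT).
Qed.

Lemma cubeU1_inj T e f : e \notin T -> e |: T = f |: T -> e = f.
Proof.
by move=> eT /setP/(_ e); rewrite !inE eqxx (negPf eT) /= orbF => /esym/eqP.
Qed.

Definition cube_sign e T : int := (-1) ^+ #|[set i in T | (i < e)%N]|.

Lemma dcoefE e s t : e \notin sedges s -> sedges t = e |: sedges s ->
  dcoef s t = cube_sign e (sedges s) * dxi e s t.
Proof.
move=> es te; rewrite /dcoef (bigD1 e) /= ?es ?te ?eqxx // big1 ?addr0 //.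
move=> f /andP[/andP[fs /eqP /(cubeU1_inj es) ->]]; by rewrite eqxx.
Qed.

Lemma dcoef_neq0 s t : dcoef s t != 0 ->
  exists2 e, e \notin sedges s & sedges t = e |: sedges s /\ dxi e s t != 0.
Proof.
move=> d0; have [e /andP[es /eqP te]] : exists e, (e \notin sedges s) && (sedges t == e |: sedges s).
  apply/existsP; apply: contraR d0 => /existsPn no; rewrite /dcoef big1 // => e.
  by rewrite (negPf (no e)).
exists e => //; split=> //; apply: contra d0 => /eqP d0.
by rewrite (dcoefE es te) d0 mulr0.
Qed.

Lemma cube_signU1 e f T : e \notin T -> 
  cube_sign f (e |: T) = cube_sign f T * (if (e < f)%N then -1 else 1).
Proof.
move=> eT; rewrite /cube_sign; case: ifP => ef.
  rewrite mulrC -exprS; congr (_ ^+ _).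
  rewrite -[in RHS]add1n; have <- : (e \notin [set i in T | (i < f)%N]) = 1%N :> nat.
    by rewrite !inE (negPf eT).
  rewrite -cardsU1; congr #|pred_of_set _|; apply/setP => i; rewrite !inE.
  by case: eqP => [->|]; rewrite ?ef.
rewrite mulr1; congr (_ ^+ _); congr #|pred_of_set _|; apply/setP => i; rewrite !inE.
by case: eqP => [->|]; rewrite ?ef ?andbF.
Qed.

Theorem dcoef_square s u : \sum_t dcoef s t * dcoef t u = 0.
Proof.
have [/eqfunP d0|] := boolP [forall t, dcoef s t * dcoef t u == 0].
  by rewrite big1.
case/forallPn => t0; rewrite mulf_eq0 negb_or => /andP[].
case/dcoef_neq0 => e es [te _] /dcoef_neq0[f ft [uf _]].
rewrite te in ft uf; have fs : f \notin sedges s by move: ft; rewrite !inE negb_or => /andP[].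
have ef : e != f by move: ft; rewrite !inE negb_or eq_sym => /andP[].
have et : e \notin f |: sedges s by rewrite !inE negb_or ef.
have ue : sedges u = e |: (f |: sedges s) by rewrite uf setUCA.
have eTf : e |: sedges s != f |: sedges s.
  by apply: contra ef => /eqP/(cubeU1_inj es) ->.
rewrite (bigID (fun t => sedges t == e |: sedges s)) /=.
rewrite [X in _ + X](bigID (fun t => sedges t == f |: sedges s)) /=.
rewrite [X in _ + (_ + X)]big1 => [|t /andP[tNe tNf]]; last first.
  apply/eqP; apply: contraR tNe; rewrite mulf_eq0 negb_or => /andP[].
  case/dcoef_neq0 => k ks [tk _] /dcoef_neq0[l lt [ul _]].
  have : k \in f |: (e |: sedges s) by rewrite -uf ul tk !inE eqxx orbT.
  rewrite !inE (negPf ks) orbF => /orP[]/eqP kE; last by rewrite tk kE.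
  by rewrite tk kE eqxx in tNf.
rewrite addr0.
have E e' f' : e' \notin sedges s -> f' \notin e' |: sedges s ->
    sedges u = f' |: (e' |: sedges s) ->
    \sum_(t | sedges t == e' |: sedges s) dcoef s t * dcoef t u =
    cube_sign e' (sedges s) * cube_sign f' (e' |: sedges s) *
    \sum_(t | sedges t == e' |: sedges s) dxi e' s t * dxi f' t u.
  move=> es' fs' uT'; rewrite mulr_sumr; apply: eq_bigr => t /eqP tT.
  by rewrite (dcoefE es' tT) (@dcoefE f') ?tT //; ring.
rewrite (E e f) //; have -> : \sum_(t | (sedges t != e |: sedges s) && (sedges t == f |: sedges s))
   dcoef s t * dcoef t u = \sum_(t | sedges t == f |: sedges s) dcoef s t * dcoef t u.
  by apply: eq_bigl => t; rewrite andb_idl // => /eqP ->; rewrite eq_sym.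
rewrite (E f e) // dxi_comm // !cube_signU1 //.
have : (e < f)%N = ~~ (f < e)%N.
  by move: ef; rewrite -val_eqE /=; case: ltngtP.
by move=> ->; case: (f < e)%N => /=; ring.
Qed.

End DifferentialSquare.

(** * Exactness of subquotients of a based complex *)

Section Exactness.

Variables (S : finType) (D : S -> S -> int) (gr : S -> int).
Hypothesis D_square : forall s u, \sum_t D s t * D t u = 0.
Hypothesis D_gr : forall s t, D s t != 0 -> gr t = gr s - 2.

Implicit Types (U V : {set S}) (d : int) (x y : S -> int).

Definition diff x t := \sum_s x s * D s t.

Definition convex U := forall s t u,
  s \in U -> u \in U -> D s t != 0 -> D t u != 0 -> t \in U.

Definition supported x U d := forall s, x s != 0 -> s \in U /\ gr s = d.

(** For a convex [U], the subquotient complex with basis [U] has no homology in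
    degree [d]. *)
Definition exact_at U d := forall x, supported x U d ->
  {in U, forall t, diff x t = 0} ->
  exists2 y, supported y U (d + 2) & {in U, forall t, diff y t = x t}.

Definition no_arrow U V := forall s t, s \in U -> t \in V -> D s t = 0.

Lemma diff_supp x U d t : supported x U (d + 2) -> diff x t != 0 -> gr t = d.
Proof.
move=> xU xt; have [s] : exists s, x s * D s t != 0.
  apply/existsP; apply: contraR xt => /existsPn no.
  by rewrite /diff big1 // => s _; apply/eqP; move: (no s); rewrite negbK.
by rewrite mulf_eq0 negb_or => /andP[/xU[_ gs] /D_gr ->]; rewrite gs addrK.
Qed.

Lemma diffB x y t : diff (fun s => x s - y s) t = diff x t - diff y t.
Proof. by rewrite -sumrB; apply: eq_bigr => s _; rewrite mulrBl. Qed.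

Lemma diffD x y t : diff (fun s => x s + y s) t = diff x t + diff y t.
Proof. by rewrite -big_split; apply: eq_bigr => s _; rewrite mulrDl. Qed.

Lemma diff_eq x y t : x =1 y -> diff x t = diff y t.
Proof. by move=> xy; apply: eq_bigr => s _; rewrite xy. Qed.

Definition restr U x s := if s \in U then x s else 0.

Lemma diff_restr U V x d t : supported x U d -> no_arrow V [set t] ->
  diff (restr (U :\: V) x) t = diff x t.
Proof.
move=> xU VT; apply: eq_bigr => s _; rewrite /restr in_setD.
have [sV|sV] /= := boolP (s \in V); first by rewrite (VT s t) ?in_set1 // !mulr0.
by case: ifP => // sU; have [->|/xU[]] := eqVneq (x s) 0; rewrite ?sU.
Qed.

(** Convexity is what lets the square of the differential of the subquotient
    be computed in the whole complex. *)
Lemma diff_square U x d : convex U -> supported x U d ->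
  {in U, forall u, diff (restr U (diff x)) u = 0}.
Proof.
move=> cU xU u uU; transitivity (\sum_s x s * \sum_t D s t * D t u); last first.
  by rewrite big1 // => s _; rewrite D_square mulr0.
under [RHS]eq_bigr do rewrite mulr_sumr.
rewrite exchange_big; apply: eq_bigr => t _ /=; rewrite /restr /diff.
case: ifPn => [_|tU].
  by rewrite mulr_suml; apply: eq_bigr => s _; rewrite mulrA.
rewrite mul0r big1 // => s _; apply/eqP; rewrite !mulf_eq0.
have [//|/xU[sU _] /=] := eqVneq (x s) 0.
by apply: contraR tU; rewrite negb_or => /andP[]; apply: cU.
Qed.

Lemma restr_supp U x d : (forall t, x t != 0 -> gr t = d) -> supported (restr U x) U d.
Proof.
by move=> xd s; rewrite /restr; case: ifP => [sU /xd //|_]; rewrite eqxx.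
Qed.

Lemma supported_sub U V x d : V \subset U -> supported x V d -> supported x U d.
Proof. by move=> VU xV s /xV[/(subsetP VU)]. Qed.

(** The long exact sequence of a subcomplex [V] and its quotient. *)
Lemma exact_extension U V d : convex U -> V \subset U -> no_arrow V (U :\: V) ->
  exact_at V d -> exact_at (U :\: V) d -> exact_at U d.
Proof.
move=> cU VU VA eV eQ x xU x0.
have arrow t : t \in U :\: V -> no_arrow V [set t].
  by move=> tQ s u sV /set1P ->; apply: VA.
have [|t tQ|y2 y2Q y2x] := eQ (restr (U :\: V) x).
- by apply: restr_supp => t /xU[].
- rewrite (diff_restr xU (arrow t tQ)) x0 //; by move: tQ; rewrite in_setD => /andP[].
have y2U : supported y2 U (d + 2) by apply: supported_sub y2Q; apply: subsetDl.
pose x' s := x s - diff y2 s.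
have x'd s : x' s != 0 -> gr s = d.
  rewrite /x' => x's; have [xs|/xU[]//] := eqVneq (x s) 0.
  by apply: (diff_supp y2U); move: x's; rewrite xs sub0r oppr_eq0.
have x'E s : restr V x' s = x s - restr U (diff y2) s.
  rewrite /restr /x'; case: ifPn => [/(subsetP VU) -> //|sV].
  case: ifPn => [sU|sU]; last first.
    by rewrite subr0; apply/esym/eqP; apply: contraR sU => /xU[].
  by rewrite y2x /restr in_setD sV sU // subrr.
have [|t tV|y1 y1V y1x] := eV (restr V x'); first exact: restr_supp.
  have tU := subsetP VU _ tV.
  by rewrite (diff_eq _ x'E) diffB x0 // (diff_square cU y2U) // subrr.
exists (fun s => y1 s + y2 s) => [s|t tU].
  by have [->|/y1V[/(subsetP VU)]//] := eqVneq (y1 s) 0; rewrite add0r => /y2U.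
rewrite diffD; have [tV|tV] := boolP (t \in V).
  by rewrite y1x // x'E /restr tU subrK.
have tQ : t \in U :\: V by rewrite in_setD tV.
rewrite y2x // /restr tQ /diff big1 ?add0r // => s _.
have [->|/y1V[sV _]] := eqVneq (y1 s) 0; first by rewrite mul0r.
by rewrite (VA s t) ?mulr0.
Qed.

(** Gaussian elimination: a complex is acyclic when the differential from the
    quotient to the subcomplex [V] is a signed bijection of bases. *)
Lemma exact_cancel U V d : convex U -> V \subset U ->
    (forall s, s \in U :\: V -> exists2 t, t \in V &
       forall s', s' \in U :\: V -> (D s' t != 0) = (s' == s)) ->
    (forall t, t \in V -> exists2 s, s \in U :\: V & D s t ^+ 2 = 1 /\
       forall t', t' \in V -> t' != t -> D s t' = 0) ->
  exact_at U d.
Proof.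
move=> cU VU Winj Vsurj x xU x0.
pose sg t := odflt t [pick s in U :\: V | (D s t ^+ 2 == 1) &&
  [forall t' in V, (t' != t) ==> (D s t' == 0)]].
have sgP t : t \in V -> [/\ sg t \in U :\: V, D (sg t) t ^+ 2 = 1 &
    forall t', t' \in V -> t' != t -> D (sg t) t' = 0].
  rewrite /sg => tV; case: pickP => [s /and3P[sW /eqP s1 /forallP s0]|no].
    split=> // t' t'V t't; apply/eqP.
    by move/implyP/(_ t'V)/implyP: (s0 t'); apply.
  have [s sW [s1 s0]] := Vsurj t tV.
  move: (no s); rewrite sW s1 eqxx /= => /forallP[t'].
  by apply/implyP => t'V; apply/implyP => t't; rewrite s0.
pose y s := \sum_(t in V) (x t * D (sg t) t) *+ (sg t == s).
have yU : supported y U (d + 2).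
  move=> s ys; have [t /andP[tV]] : exists t, (t \in V) && (x t * D (sg t) t *+ (sg t == s) != 0).
    apply/existsP; apply: contraR ys => /existsPn no; rewrite /y big1 // => t tV.
    by apply/eqP; move: (no t); rewrite tV negbK.
  have [<-|_] := eqVneq (sg t) s; last by rewrite mulr0n eqxx.
  rewrite mulr1n mulf_eq0 negb_or => /andP[/xU[_ <-] /D_gr ->].
  by have [] := sgP t tV; rewrite in_setD => /andP[_ ->] _ _; rewrite subrK.
have yV t : t \in V -> diff y t = x t.
  move=> tV; transitivity (\sum_(t' in V) x t' * D (sg t') t' * D (sg t') t).
    rewrite /diff /y; under eq_bigr do rewrite mulr_suml.
    rewrite exchange_big; apply: eq_bigr => t' _ /=.
    rewrite (bigD1 (sg t')) //= eqxx mulr1n big1 ?addr0 // => s ss.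
    by rewrite eq_sym (negPf ss) mulr0n mul0r.
  have [_ s1 _] := sgP t tV.
  rewrite (bigD1 t) //= -mulrA -expr2 s1 mulr1 big1 ?addr0 // => t' /andP[t'V t't].
  by have [_ _ s0] := sgP t' t'V; rewrite (s0 t tV) ?mulr0 // eq_sym.
pose x' s := x s - restr U (diff y) s.
have x'W s : x' s != 0 -> s \in U :\: V.
  rewrite /x' /restr in_setD => x's; have [sV|sV] /= := boolP (s \in V).
    by move: x's; rewrite (subsetP VU) // yV // subrr eqxx.
  by apply: contraR x's => sU; rewrite (negPf sU) subr0; apply: contraR sU => /xU[].
have x'0 s : x' s = 0.
  apply/eqP; apply: contraT => x's; have sW := x'W s x's.
  have [t tV tP] := Winj s sW; have tU := subsetP VU _ tV.
  have : diff x' t = 0 by rewrite diffB x0 // (diff_square cU yU) // subrr.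
  rewrite /diff (bigD1 s) //= big1 ?addr0 => [|s' s's].
    by move/eqP; rewrite mulf_eq0 (negPf x's) /= => Dst; move: (tP s sW); rewrite Dst eqxx.
  have [->|/x'W s'W] := eqVneq (x' s') 0; first by rewrite mul0r.
  by apply/eqP; rewrite mulf_eq0 orbC -[D s' t == 0]negbK tP // s's.
exists y => // t tU; move: (x'0 t); rewrite /x' /restr tU => /eqP.
by rewrite subr_eq0 => /eqP.
Qed.

End Exactness.

(** * Flat vertices of a subcube *)

Section Flat.

Variable G : ribbonGraph.
Implicit Types (A B Q T : {set edge G}) (e f : edge G) (a b p : bnd_arc G).

Definition toggle e T := if e \in T then T :\ e else e |: T.

Lemma in_toggle e T f : (f \in toggle e T) = (f == e) (+) (f \in T).
Proof.
rewrite /toggle; case: ifP => eT; rewrite !inE; case: eqP => [->|_] //=; by rewrite eT.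
Qed.

Lemma joins_toggle e T : joins (toggle e T) e = ~~ joins T e.
Proof.
rewrite /toggle; case: ifPn => eT; last by rewrite joinsU1.
by rewrite -{2}(setD1K eT) joinsU1 ?negbK // !inE eqxx.
Qed.

Lemma card_toggle e T : (#|bcomps (toggle e T)| + (joins T e).*2 = #|bcomps T| + 1)%N.
Proof.
rewrite /toggle; case: ifPn => eT; last exact: card_bcompsU1.
have eT' : e \notin T :\ e by rewrite !inE eqxx.
have := card_bcompsU1 eT'; have := joinsU1 eT'; rewrite (setD1K eT) => ->.
by case: (joins _ _) => /=; lia.
Qed.

Lemma bcompU_toggle e T :
  bcomp (toggle e T) (arc_at (e, false)) :|: bcomp (toggle e T) (arc_at (e, true)) =
  bcomp T (arc_at (e, false)) :|: bcomp T (arc_at (e, true)).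
Proof.
rewrite /toggle; case: ifPn => eT; last exact: bcompU1.
by rewrite -{3 4}(setD1K eT) bcompU1 // !inE eqxx.
Qed.

Lemma bcomp_toggle_other e T a : bcomp T a \notin ends T e ->
  bcomp (toggle e T) a = bcomp T a.
Proof.
rewrite /toggle; case: ifPn => eT; last exact: bcompU1_other.
have eT' : e \notin T :\ e by rewrite !inE eqxx.
move=> aN; have := @bcompU1_other G (T :\ e) e a eT'; rewrite (setD1K eT) => -> //.
by rewrite -(ends_memU1 _ eT') (setD1K eT).
Qed.

Definition between A B T := (A \subset T) && (T \subset B).

Lemma between_toggle A B T e : e \in B :\: A -> between A B T -> between A B (toggle e T).
Proof.
rewrite in_setD => /andP[eA eB] /andP[AT TB]; apply/andP; split; apply/subsetP => f.
  rewrite in_toggle => fA; rewrite (subsetP AT) //; case: eqP fA eA => [->|_ //] -> //.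
by rewrite in_toggle; case: eqP => [->|_ /= /(subsetP TB)].
Qed.

Lemma between_eq A B T T' e : e \notin B :\: A -> between A B T -> between A B T' ->
  (e \in T) = (e \in T').
Proof.
rewrite in_setD negb_and negbK => eN /andP[/subsetP AT /subsetP TB] /andP[/subsetP AT' /subsetP TB'].
have [eA|eA] := boolP (e \in A); first by rewrite AT // AT'.
have {eN} eB : e \notin B by rewrite (negPf eA) in eN.
by apply/idP/idP => [/TB|/TB']; rewrite (negPf eB).
Qed.

Lemma cross_eq (T T' : {set edge G}) (x : halfedge G) :
  (x.1 \in T) = (x.1 \in T') -> cross T x = cross T' x.
Proof. by rewrite /cross => ->. Qed.

(** A flat [Q] is a local minimum of the number of boundary components on the
    cube between [A] and [B]; by [flat_image] it is a global minimum, and by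
    [flat_bcomp] all global minima have the same components. *)
Definition flat A B Q := between A B Q /\ forall f, f \in B :\: A -> ~~ joins Q f.

Lemma bcomp_next T a : bcomp T (bnd_perm T a) = bcomp T a.
Proof. by have := porbit_perm (bnd_perm T) 1 a; rewrite expg1. Qed.

Lemma not_joins T e (b b' : bool) : ~~ joins T e -> bcomp T (arc_at (e, b)) = bcomp T (arc_at (e, b')).
Proof. by rewrite negbK => /eqP eT; case: b; case: b'. Qed.

Lemma flat_next A B Q T a : flat A B Q -> between A B T ->
  bcomp Q (bnd_perm T a) = bcomp Q a.
Proof.
move=> [ABQ fQ] ABT; rewrite -[RHS]bcomp_next !(permE (@bnd_next_inj G _)).
case: a => [x|//] /=; set y := Defs.rot G x.
have [/fQ yJ|yN] := boolP (y.1 \in B :\: A); last first.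
  by rewrite (cross_eq (between_eq yN ABT ABQ)).
have E (I : {set edge G}) : exists b : bool, cross I y = (y.1, b).
  by rewrite /cross; case: ifP => _; [exists (~~ y.2)|exists y.2; case: (y)].
by have [b ->] := E T; have [b' ->] := E Q; apply: not_joins.
Qed.

(** The boundary walk of [T] differs from that of [Q] only by jumps between the
    two ends of a band, which lie on one component of [Q]. *)
Lemma flat_stable A B Q T a : flat A B Q -> between A B T ->
  stable (bnd_perm T) (bcomp Q a).
Proof.
by move=> fQ ABT; apply/forallP => z; rewrite -!bcomp_eq (flat_next _ fQ ABT).
Qed.

Lemma flat_sub A B Q T a : flat A B Q -> between A B T -> bcomp T a \subset bcomp Q a.
Proof. by move=> fQ ABT; rewrite stable_sub ?bcomp_id //; apply: flat_stable fQ ABT. Qed.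

Lemma flat_coarser A B Q T a b : flat A B Q -> between A B T ->
  bcomp T a = bcomp T b -> bcomp Q a = bcomp Q b.
Proof.
move=> fQ ABT /eqP; rewrite bcomp_eq => /(subsetP (flat_sub b fQ ABT)).
by rewrite -bcomp_eq => /eqP.
Qed.

Lemma flat_image A B Q T : flat A B Q -> between A B T ->
  {f : {set bnd_arc G} -> {set bnd_arc G} | bcomps Q = f @: bcomps T &
     forall a, f (bcomp T a) = bcomp Q a}.
Proof.
move=> fQ ABT; pose f (c : {set bnd_arc G}) := \bigcup_(a in c) bcomp Q a.
have fE a : f (bcomp T a) = bcomp Q a.
  apply/setP => z; apply/bigcupP/idP => [[b /(subsetP (flat_sub a fQ ABT))]|zQ].
    by rewrite -bcomp_eq => /eqP->.
  by exists a; rewrite ?bcomp_id.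
exists f => //; apply/setP => c; apply/idP/imsetP => [/mem_porbits[a ->]|[d /mem_porbits[a ->] ->]].
  by exists (bcomp T a); rewrite ?fE ?bcomp_in_bcomps.
by rewrite -/(bcomp _ _) fE bcomp_in_bcomps.
Qed.

Lemma flat_bcomp A B Q T a : flat A B Q -> between A B T ->
  #|bcomps T| = #|bcomps Q| -> bcomp T a = bcomp Q a.
Proof.
move=> fQ ABT; have [f QE fE] := flat_image fQ ABT; rewrite QE => /esym/eqP/imset_injP inj.
apply/eqP; rewrite eqEsubset (flat_sub a fQ ABT); apply/subsetP => b.
rewrite -!bcomp_eq -!fE => /eqP/inj-> //; exact: bcomp_in_bcomps.
Qed.

Lemma flat_eq A B Q T : flat A B Q -> between A B T -> #|bcomps T| = #|bcomps Q| ->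
  flat A B T.
Proof.
move=> fQ ABT TQ; split=> // f /(proj2 fQ); by rewrite /joins !(flat_bcomp _ fQ ABT TQ).
Qed.

Lemma flat_subcube A B A' B' Q : flat A B Q -> A \subset A' -> B' \subset B ->
  between A' B' Q -> flat A' B' Q.
Proof.
move=> [_ fQ] AA' B'B ABQ; split=> // f fBA; apply: fQ.
exact: subsetP (setDSS B'B AA') _ fBA.
Qed.

(** Toggling a band that meets two components of a minimum would lower it. *)
Lemma flat_min A B : A \subset B -> exists Q, flat A B Q.
Proof.
move=> AB; have ABA : between A B A by rewrite /between subxx.
case: (arg_minnP (fun T : {set edge G} => #|bcomps T|) ABA) => Q ABQ Qmin.
exists Q; split=> // f fBA; apply/negP => jQ.
have := Qmin _ (between_toggle fBA ABQ); have := card_toggle f Q; rewrite jQ /=; lia.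
Qed.

End Flat.

(** * Marked subcubes *)

Section Marked.

Variable G : ribbonGraph.
Implicit Types (A B Q T : {set edge G}) (e f : edge G) (a p : bnd_arc G) (s t u : state G).
Implicit Types (M : {set bnd_arc G * bool}) (d : int).

(** Twice the diagonal grading, with the shift of the reduced complex. *)
Definition dgr s : int := qdeg s + 1 - 2 * hdeg s.

Lemma dcoef_dgr s t : dcoef s t != 0 -> dgr t = dgr s - 2.
Proof.
case/dcoef_neq0 => e es [te]; rewrite (dxi_leexi es te) /dgr (hdegU1 es te).
by have [->|_] := eqVneq (qdeg t) (qdeg s) => [_|/eqP[]]; first ring.
Qed.

Lemma label_away e s t a : e \notin sedges s -> sedges t = e |: sedges s ->
  same_away e s t -> bcomp (sedges s) a \notin ends (sedges s) e -> label t a = label s a.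
Proof.
move=> es te sa aN; have aN' : bcomp (sedges t) a \notin ends (sedges t) e.
  by rewrite te ends_memU1.
move/eqP/setP/(_ (bcomp (sedges s) a)): sa.
have -> : bcomp (sedges s) a = bcomp (sedges t) a by rewrite te bcompU1_other.
rewrite in_setD [in RHS]in_setD aN' /label /=.
have -> : bcomp (sedges t) a = bcomp (sedges s) a by rewrite te bcompU1_other.
by rewrite aN.
Qed.

Lemma label_ends s e a : bcomp (sedges s) a \in ends (sedges s) e ->
  exists b, label s a = label s (arc_at (e, b)).
Proof.
by rewrite !inE => /orP[]/eqP E; [exists false|exists true]; rewrite /label E.
Qed.

(** A component labelled v_- gives v_- whenever it merges or splits. Hence fixing
    labels at marked arcs cuts out a subquotient complex. *)
Lemma label_mono s t a : dcoef s t != 0 -> label t a -> label s a.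
Proof.
case/dcoef_neq0 => e es [te d0]; have sa : same_away e s t.
  by move: d0; rewrite dxiE; case: ifP => // _; rewrite eqxx.
have [aE|aN] := boolP (bcomp (sedges s) a \in ends (sedges s) e); last first.
  by rewrite (label_away es te sa aN).
have aE' : bcomp (sedges t) a \in ends (sedges t) e by rewrite te ends_memU1.
have [b ->] := label_ends aE; have [b' ->] := label_ends aE'.
have jt : joins (sedges t) e = ~~ joins (sedges s) e by rewrite te joinsU1.
have tE : joins (sedges s) e ->
    label t (arc_at (e, true)) = label t (arc_at (e, false)).
  by move=> js; rewrite /label (@not_joins _ _ _ true false) // jt js.
have sE : ~~ joins (sedges s) e ->
    label s (arc_at (e, true)) = label s (arc_at (e, false)).
  by move=> js; rewrite /label (@not_joins _ _ _ true false).
move: d0; rewrite dxiE sa; case: ifPn => [/tE|/sE];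
by case: b; case: b' => E; rewrite ?E; case: (label s (arc_at (e, false))); case: (label s (arc_at (e, true)));
  case: (label t (arc_at (e, false))); case: (label t (arc_at (e, true))).
Qed.

Lemma state_ext e s t : sedges s = sedges t ->
  splus s :\: ends (sedges s) e = splus t :\: ends (sedges s) e ->
  (forall b, label s (arc_at (e, b)) = label t (arc_at (e, b))) -> s = t.
Proof.
move=> st sp lb; rewrite (relabelK st (e := e) (P := splus t)) -?st // !lb.
by rewrite -relabelK.
Qed.

Definition marked A B M : {set state G} :=
  [set s | between A B (sedges s) & [forall m in M, label s m.1 == m.2]].

Lemma markedP A B M s : reflect (between A B (sedges s) /\
  forall m, m \in M -> label s m.1 = m.2) (s \in marked A B M).
Proof.
rewrite inE; apply: (iffP andP) => -[-> H]; split=> //.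
  by move=> m mM; apply/eqP; move/forallP/(_ m)/implyP: H; apply.
by apply/forallP => m; apply/implyP => mM; rewrite H.
Qed.

Lemma marked_convex A B M : convex (@dcoef G) (marked A B M).
Proof.
move=> s t u /markedP[/andP[As _] sM] /markedP[/andP[_ uB] uM] st tu; apply/markedP.
have [e es [te _]] := dcoef_neq0 st; have [f ft [uf _]] := dcoef_neq0 tu; split.
  rewrite /between te subsetU ?As ?orbT //=; apply: subset_trans uB.
  by rewrite uf te subsetUr.
move=> m mM; apply/idP/idP => [/(label_mono st)|m2]; first by rewrite sM.
by apply: (label_mono tu); rewrite uM.
Qed.

(** The marks then prescribe the labels of every component of [Q], so that a
    marked state over [Q] is unique. *)
Definition transversal M Q :=
  (forall a, exists2 m, m \in M & m.1 \in bcomp Q a) /\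
  {in M &, forall m m', bcomp Q m.1 = bcomp Q m'.1 -> m = m'}.

Definition marks_sum M : int := \sum_(m in M) sgn (~~ m.2).

Lemma dgr_marked M Q s : transversal M Q -> sedges s = Q ->
  (forall m, m \in M -> label s m.1 = m.2) -> dgr s = marks_sum M + 1 - #|Q|%:Z.
Proof.
move=> [cov inj] sQ sM; rewrite /dgr qdeg_sum sQ.
have -> : bcomps Q = [set bcomp Q m.1 | m in M].
  apply/setP => c; apply/idP/imsetP => [/mem_porbits[a ->]|[m _ ->]]; last exact: bcomp_in_bcomps.
  by have [m mM] := cov a; rewrite -bcomp_eq => /eqP E; exists m; rewrite ?E.
rewrite big_imset //= /marks_sum (eq_bigr (fun m => sgn (~~ m.2))) => [|m /sM <-].
  by rewrite /hdeg sQ; ring.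
by rewrite /label sQ.
Qed.

(** Follow the boundary from marks until it meets a band that may be toggled:
    up to there the path does not depend on the vertex of the cube. *)
Lemma first_band A B M Q : flat A B Q -> transversal M Q -> B :\: A != set0 ->
  exists m e b, [/\ m \in M, e \in B :\: A &
    forall T, between A B T -> arc_at (e, b (+) (e \in T)) \in bcomp T m.1].
Proof.
move=> [ABQ _] [cov _] /set0Pn[f fBA]; have [m mM] := cov (arc_at (f, false)).
set p := m.1; pose hit k := if (bnd_perm Q ^+ k)%g p is inl x
  then (Defs.rot G x).1 \in B :\: A else false.
rewrite -bcomp_eq => /eqP pf; have [k0 hk0] : exists k, hit k.
  pose z := (bnd_perm Q)^-1%g (arc_at (f, false)).
  have zf : bnd_perm Q z = arc_at (f, false) by rewrite permKV.
  have /porbitP[k kz] : z \in bcomp Q p.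
    by rewrite pf -bcomp_eq -(bcomp_next Q z) zf.
  exists k; rewrite /hit -kz; move: zf; rewrite (permE (@bnd_next_inj G _)).
  case: (z) => [x|//] /= -[]; rewrite /cross; case: ifP => _; last by move=> ->.
  by case=> ->.
(* The first hit: before it the walk meets only bands on which all vertices of
   the cube agree. *)
have [k hk kmin] := ex_minnP (ex_intro _ k0 hk0).
have walk T j : between A B T -> (j <= k)%N -> (bnd_perm T ^+ j)%g p = (bnd_perm Q ^+ j)%g p.
  move=> ABT; elim: j => [|j IHj] jk; first by rewrite !expg0.
  rewrite !expgSr !permM IHj; last exact: ltnW.
  have : ~~ hit j by apply: contraL jk => /kmin; rewrite -leqNgt.
  rewrite /hit; case: (_ p) => [x|v]; rewrite !(permE (@bnd_next_inj G _)) //= => xN.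
  by rewrite (cross_eq (between_eq xN ABT ABQ)).
move: hk; rewrite /hit; case pk: (_ p) => [x|//]; set y := Defs.rot G x => yBA.
exists m, y.1, y.2; split=> // T ABT.
have -> : arc_at (y.1, y.2 (+) (y.1 \in T)) = bnd_perm T (inl x).
  rewrite (permE (@bnd_next_inj G _)) /= /arc_at /cross -/y.
  by case: ifP => _; rewrite ?addbT ?addbF; case: (y).
rewrite -bcomp_eq bcomp_next bcomp_eq -pk -(walk T k) //; exact: mem_porbit.
Qed.

End Marked.

Section Cancellation.

Variable G : ribbonGraph.
Implicit Types (A B Q T : {set edge G}) (e f : edge G) (a p : bnd_arc G) (s t u : state G).
Implicit Types (M : {set bnd_arc G * bool}) (d : int) (W V : {set state G}).
Implicit Types (P : {set {set bnd_arc G}}).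

Lemma relabel_exists e T P (l : bool -> bool) : P \subset bcomps T :\: ends T e ->
    joins T e || (l false == l true) ->
  exists s, [/\ sedges s = T, splus s :\: ends T e = P
              & forall b, label s (arc_at (e, b)) = l b].
Proof.
move=> PT jl; have PE : P :\: ends T e = P.
  apply/setP => c; rewrite in_setD andb_idl // => /(subsetP PT).
  by rewrite in_setD => /andP[].
exists (relabel T e P (l false) (l true)); split=> [//||[]].
- by rewrite relabel_away ?PE //; apply: subset_trans PT (subsetDl _ _).
- exact: relabel1.
- exact: relabel0.
Qed.

Lemma target_exists e s (l : bool -> bool) : e \notin sedges s ->
    joins (e |: sedges s) e || (l false == l true) ->
  exists t, [/\ sedges t = e |: sedges s, same_away e s t
              & forall b, label t (arc_at (e, b)) = l b].
Proof.
move=> es jl; have [|t [te tP tl]] := @relabel_exists e _ (splus s :\: ends (sedges s) e) l _ jl.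
  by rewrite bcompsU1 // setSD // splus_sub.
by exists t; split=> //; rewrite /same_away te tP.
Qed.

Lemma source_exists e t (l : bool -> bool) : e \in sedges t ->
    joins (sedges t :\ e) e || (l false == l true) ->
  exists s, [/\ sedges t = e |: sedges s, e \notin sedges s, same_away e s t
              & forall b, label s (arc_at (e, b)) = l b].
Proof.
move=> et jl; have eT : e \notin sedges t :\ e by rewrite !inE eqxx.
have [|s [se sP sl]] := @relabel_exists e _ (splus t :\: ends (sedges t) e) l _ jl.
  by rewrite -bcompsU1 // setD1K // setSD // splus_sub.
by exists s; split=> //; rewrite ?se ?setD1K // /same_away se sP.
Qed.

(** When the labels at the band of [e] are prescribed on both sides, the states
    on the two sides are matched by their labels elsewhere, and the differential
    along [e] is this matching up to signs. *)
Lemma cancel_along e W V d : convex (@dcoef G) (W :|: V) ->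
    {in W, forall s, e \notin sedges s} -> {in V, forall t, e \in sedges t} ->
    {in W & V, forall s t, sedges t = e |: sedges s -> same_away e s t -> dxi e s t = 1} ->
    {in W &, forall s s', forall b, label s (arc_at (e, b)) = label s' (arc_at (e, b))} ->
    {in V &, forall t t', forall b, label t (arc_at (e, b)) = label t' (arc_at (e, b))} ->
    {in W, forall s, exists2 t, t \in V & sedges t = e |: sedges s /\ same_away e s t} ->
    {in V, forall t, exists2 s, s \in W & sedges t = e |: sedges s /\ same_away e s t} ->
  exact_at (@dcoef G) (@dgr G) (W :|: V) d.
Proof.
move=> cU We Ve d1 Wl Vl Wt Vs.
have WE : (W :|: V) :\: V = W.
  apply/setP => s; rewrite in_setD in_setU; have [sW|_] := boolP (s \in W).
    by rewrite andbT; apply/negP => /Ve; rewrite (negPf (We s sW)).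
  by case: (s \in V).
have arrow s t : s \in W -> t \in V -> dcoef s t != 0 ->
    sedges t = e |: sedges s /\ same_away e s t.
  move=> sW tV /dcoef_neq0[k ks [tk dk]]; have ke : k = e.
    by move: (Ve t tV); rewrite tk !inE (negPf (We s sW)) orbF => /eqP.
  by split; [rewrite tk ke|move: dk; rewrite ke dxiE; case: ifP; rewrite ?eqxx].
have dE s t : s \in W -> t \in V -> sedges t = e |: sedges s -> same_away e s t ->
    dcoef s t = cube_sign e (sedges s).
  by move=> sW tV te sa; rewrite (dcoefE (We s sW) te) d1 // mulr1.
apply: (exact_cancel (@dcoef_square G) (@dcoef_dgr G) (V := V)) => //.
- exact: subsetUr.
- rewrite WE => s sW; have [t tV [te sa]] := Wt s sW; exists t => // s' s'W.
  apply/idP/eqP => [/(arrow s' t s'W tV)[te' sa']|->].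
    have ss : sedges s' = sedges s.
      by rewrite -(setU1K (We s sW)) -te te' setU1K // We.
    apply: (state_ext (e := e)) => //; last exact: Wl.
    by move/eqP: sa => sa; move/eqP: sa'; rewrite -sa ss.
  by rewrite dE // signr_eq0.
- rewrite WE => t tV; have [s sW [te sa]] := Vs t tV; exists s => //; split.
    by rewrite dE // /cube_sign sqrr_sign.
  move=> t' t'V; apply: contraNeq => /(arrow s t' sW t'V)[te' sa']; apply/eqP.
  apply: (state_ext (e := e)); rewrite ?te ?te' //; last exact: Vl.
  by move: sa sa'; rewrite /same_away te te' => /eqP <- /eqP.
Qed.

End Cancellation.

(** Here [e] is the first band that may be toggled on the way from the mark [m],
    so at every vertex of the cube one of its ends is on the marked component. After
    toggling [e] in a flat [Q] its other end [q] lies on a new component, where a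
    new mark is placed. *)
Section Step.

Variables (G : ribbonGraph) (A B Q : {set edge G}) (M : {set bnd_arc G * bool}).
Variables (e : edge G) (b : bool) (m : bnd_arc G * bool).
Hypotheses (flatQ : flat A B Q) (transQ : transversal M Q).
Hypotheses (eBA : e \in B :\: A) (mM : m \in M).
Hypothesis near : forall T, between A B T -> arc_at (e, b (+) (e \in T)) \in bcomp T m.1.

Let Q' := toggle e Q.
Let q := arc_at (e, b (+) (e \in Q)).
Implicit Types (T : {set edge G}) (s t : state G).

Lemma between_toggleQ : between A B Q'.
Proof. by apply: between_toggle => //; case: flatQ. Qed.

Lemma joins_toggleQ : joins Q' e.
Proof. by rewrite joins_toggle (proj2 flatQ). Qed.

Lemma near_label s : between A B (sedges s) ->
  label s m.1 = label s (arc_at (e, b (+) (e \in sedges s))).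
Proof. by move=> ABs; apply/esym/label_bcomp/near. Qed.

Lemma bcompQ_ends b' : bcomp Q (arc_at (e, b')) = bcomp Q m.1.
Proof.
have [ABQ jQ] := flatQ; have := near ABQ; rewrite -bcomp_eq => /eqP <-.
by apply: not_joins; apply: jQ.
Qed.

Lemma mark_ends T m' : between A B T -> m' \in M ->
  bcomp T m'.1 \in ends T e -> m' = m.
Proof.
move=> ABT m'M m'e; apply: (proj2 transQ) => //.
by move: m'e; rewrite !inE => /orP[]/eqP/(flat_coarser flatQ ABT) ->; rewrite bcompQ_ends.
Qed.

Lemma bcompQ'_neq : bcomp Q' q != bcomp Q' m.1.
Proof.
have := near between_toggleQ; rewrite -bcomp_eq => /eqP <-.
have := joins_toggleQ; rewrite /joins /q in_toggle eqxx /=.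
by case: (b); case: (e \in Q) => //=; rewrite eq_sym.
Qed.

Lemma new_mark (l : bool) : (q, l) \notin M.
Proof.
apply: contra bcompQ'_neq => qM; rewrite -(mark_ends (proj1 flatQ) qM) //=.
by rewrite !inE /q; case: (b (+) _); rewrite eqxx ?orbT.
Qed.

Lemma transversal_toggle (l : bool) : transversal ((q, l) |: M) Q'.
Proof.
have [cov inj] := transQ; split=> [a|].
  have [aE|aN] := boolP (bcomp Q a \in ends Q e); last first.
    have [m' m'M m'a] := cov a; exists m'; first by rewrite setU1r.
    by rewrite bcomp_toggle_other.
  have [aq|aq] := boolP (a \in bcomp Q' q).
    by exists (q, l); rewrite ?setU11 // -bcomp_eq /= eq_sym bcomp_eq.
  exists m; first by rewrite setU1r.
  have := near between_toggleQ; rewrite -!bcomp_eq eq_sym => /eqP ->.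
  move: aE; rewrite ends_mem -bcompU_toggle -/Q' -ends_mem !inE.
  move: aq; rewrite -bcomp_eq /q in_toggle eqxx /=.
  by case: (b); case: (e \in Q) => /=; case: (_ == _) => //=; rewrite ?orbF // eq_sym.
have inj' m' : m' \in M -> bcomp Q' q = bcomp Q' m'.1 -> False.
  move=> m'M qm'; have := bcompQ'_neq; rewrite qm'; apply/negP/negPn/eqP.
  congr (bcomp Q' _.1); apply: inj => //.
  by rewrite -(flat_coarser flatQ between_toggleQ qm') bcompQ_ends.
move=> m1 m2 /setU1P[->|m1M] /setU1P[->|m2M] //= E.
- by case: (inj' m2).
- by case: (inj' m1).
by apply: inj => //; apply: (flat_coarser flatQ between_toggleQ).
Qed.

Lemma marks_sum_toggle (l : bool) : marks_sum ((q, l) |: M) = sgn (~~ l) + marks_sum M.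
Proof. by rewrite /marks_sum big_setU1 ?new_mark. Qed.

Lemma marks_away s t : between A B (sedges s) ->
    e \notin sedges s -> sedges t = e |: sedges s -> same_away e s t ->
    label t m.1 = m.2 ->
    {in M, forall m', label s m'.1 = m'.2} -> {in M, forall m', label t m'.1 = m'.2}.
Proof.
move=> ABs es te sa tm sM m' m'M.
have [m'e|m'N] := boolP (bcomp (sedges s) m'.1 \in ends (sedges s) e).
  by rewrite (mark_ends ABs m'M m'e).
by rewrite (label_away es te sa m'N) sM.
Qed.

Lemma marks_away_source s t : between A B (sedges s) ->
    e \notin sedges s -> sedges t = e |: sedges s -> same_away e s t ->
    label s m.1 = m.2 ->
    {in M, forall m', label t m'.1 = m'.2} -> {in M, forall m', label s m'.1 = m'.2}.
Proof.
move=> ABs es te sa sm tM m' m'M.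
have [m'e|m'N] := boolP (bcomp (sedges s) m'.1 \in ends (sedges s) e).
  by rewrite (mark_ends ABs m'M m'e).
by rewrite -(label_away es te sa m'N) tM.
Qed.

Lemma between_del T : between A (B :\ e) T = (between A B T && (e \notin T)).
Proof. by rewrite /between subsetD1 andbA. Qed.

Lemma between_add T : between (e |: A) B T = (between A B T && (e \in T)).
Proof. by rewrite /between subUset sub1set -andbA andbC. Qed.

Lemma between_U1 T : between A B T -> between A B (e |: T).
Proof.
move=> /andP[AT TB]; rewrite /between subsetU ?AT ?orbT //= subUset TB andbT sub1set.
by move: eBA; rewrite in_setD => /andP[].
Qed.

Lemma between_D1 T : between A B T -> between A B (T :\ e).
Proof.
move=> /andP[AT TB]; rewrite /between subsetD1 AT (subset_trans (subsetDl _ _) TB) andbT.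
by move: eBA; rewrite in_setD => /andP[].
Qed.

Lemma markedU1P A' B' l s : reflect
  [/\ between A' B' (sedges s), label s q = l & {in M, forall m', label s m'.1 = m'.2}]
  (s \in marked A' B' ((q, l) |: M)).
Proof.
apply: (iffP (markedP _ _ _ _)) => [[ABs sM]|[ABs sq sM]].
  by split=> // [|m' m'M]; [exact: (sM (q, l) (setU11 _ _))|exact/sM/setU1r].
by split=> // m' /setU1P[->|/sM].
Qed.

Lemma joins_half A' B' T : flat A' B' Q' -> between A' B' T -> joins T e.
Proof.
move=> flatQ' ABT; apply: contra joins_toggleQ => /eqP E.
by apply/eqP; apply: flat_coarser flatQ' ABT E.
Qed.

Lemma dcoef_band s t : e \notin sedges s -> e \in sedges t -> dcoef s t != 0 ->
  sedges t = e |: sedges s /\ dxi e s t != 0.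
Proof.
move=> es et /dcoef_neq0[k ks [tk dk]]; suff <- : k = e by [].
by move: et; rewrite tk !inE (negPf es) orbF => /eqP.
Qed.

(** Delta v_- involves only v_-, and no term of Delta v_+ has v_+ at both ends. *)
Lemma no_arrow_split : e \notin Q -> flat (e |: A) B Q' ->
  no_arrow (@dcoef G) (marked A (B :\ e) M) (marked (e |: A) B ((q, true) |: M)).
Proof.
move=> eQ flatQ' s t /markedP[]; rewrite between_del => /andP[ABs es] sM.
case/markedU1P => ABt; have := ABt; rewrite between_add => /andP[ABt' et] tq tM.
apply/eqP; apply: contraT => d0; have [te] := dcoef_band es et d0.
have js : ~~ joins (sedges s) e by rewrite -joinsU1 // -te (joins_half flatQ').
have sl b' : label s (arc_at (e, b')) = m.2.
  rewrite -(sM m mM) near_label // (negPf es) addbF.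
  by rewrite /label (not_joins _ b js).
have qE : q = arc_at (e, b) by rewrite /q (negPf eQ) addbF.
have m2 : m.2 = true by rewrite -(sl b) -qE (label_mono d0).
have tl b' : label t (arc_at (e, b')).
  have [->|b'b] := eqVneq b' b; first by rewrite -qE.
  have -> : b' = ~~ b by case: (b') (b) b'b => -[].
  by have := tM m mM; rewrite near_label // et addbT m2 => ->.
by rewrite dxiE (negPf js) !sl !tl m2; case: ifP.
Qed.

(** A merge of v_- with the marked component has no component in the states
    where the mark keeps its label: v_- * v_- = 0, and v_+ * v_- = v_-. *)
Lemma no_arrow_merge : e \in Q -> flat A (B :\ e) Q' ->
  no_arrow (@dcoef G) (marked A (B :\ e) ((q, false) |: M)) (marked (e |: A) B M).
Proof.
move=> eQ flatQ' s t /markedU1P[ABs]; have := ABs; rewrite between_del => /andP[ABs' es] sq sM.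
case/markedP; rewrite between_add => /andP[ABt et] tM.
apply/eqP; apply: contraT => d0; have [te] := dcoef_band es et d0.
have js : joins (sedges s) e by apply: joins_half flatQ' ABs.
have qE : q = arc_at (e, ~~ b) by rewrite /q eQ addbT.
have m2 : m.2 = false.
  apply/negP => m2; suff : label s q by rewrite sq.
  by apply: (label_mono d0); rewrite qE -addbT -et -near_label // tM.
have sl b' : label s (arc_at (e, b')) = false.
  have [->|b'b] := eqVneq b' b.
    by rewrite -m2 -(sM m mM) near_label // (negPf es) addbF.
  by rewrite -sq qE; case: (b') (b) b'b => -[].
by rewrite dxiE js !sl; case: ifP.
Qed.

(** Delta v has exactly one term with v at the marked end and v_- at the new end,
    with coefficient one; this term is the matching. *)
Lemma cancel_split d : e \notin Q -> flat (e |: A) B Q' ->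
    convex (@dcoef G) (marked A (B :\ e) M :|: marked (e |: A) B ((q, false) |: M)) ->
  exact_at (@dcoef G) (@dgr G)
    (marked A (B :\ e) M :|: marked (e |: A) B ((q, false) |: M)) d.
Proof.
move=> eQ flatQ' cU; have qE : q = arc_at (e, b) by rewrite /q (negPf eQ) addbF.
have jT := joins_half flatQ'.
have sW s : s \in marked A (B :\ e) M -> [/\ between A B (sedges s), e \notin sedges s,
    ~~ joins (sedges s) e, forall b', label s (arc_at (e, b')) = m.2 &
    {in M, forall m', label s m'.1 = m'.2}].
  case/markedP; rewrite between_del => /andP[ABs es] sM.
  have js : ~~ joins (sedges s) e.
    by rewrite -joinsU1 // jT // between_add between_U1 // !inE eqxx.
  split=> // b'; rewrite -(sM m mM) near_label // (negPf es) addbF.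
  by rewrite /label (not_joins _ b js).
have tV t : t \in marked (e |: A) B ((q, false) |: M) -> [/\ between A B (sedges t),
    e \in sedges t, joins (sedges t) e,
    forall b', label t (arc_at (e, b')) = if b' == b then false else m.2 &
    {in M, forall m', label t m'.1 = m'.2}].
  case/markedU1P => ABt; have := ABt; rewrite between_add => /andP[ABt' et] tq tM.
  split=> //; first exact: jT.
  move=> b'; case: eqP => [->|/eqP b'b]; first by rewrite -qE.
  by rewrite -(tM m mM) near_label // et addbT; case: (b') (b) b'b => -[].
apply: (cancel_along (e := e)) => //.
- by move=> s /sW[].
- by move=> t /tV[].
- move=> s t /sW[_ _ js sl _] /tV[_ _ _ tl _] te sa.
  by rewrite dxiE sa (negPf js) !sl !tl; case: (b); case: (m.2).
- by move=> s s' /sW[_ _ _ sl _] /sW[_ _ _ sl' _] b'; rewrite sl sl'.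
- by move=> t t' /tV[_ _ _ tl _] /tV[_ _ _ tl' _] b'; rewrite tl tl'.
- move=> s /sW[ABs es js sl sM].
  have ABt : between (e |: A) B (e |: sedges s) by rewrite between_add between_U1 // !inE eqxx.
  have [|t [te sa tl]] := @target_exists _ e s (fun b' => if b' == b then false else m.2) es.
    by rewrite jT.
  exists t => //; apply/markedU1P; rewrite te; split=> //; first by rewrite qE tl eqxx.
  apply: marks_away sM => //; rewrite near_label ?te ?between_U1 // !inE eqxx addbT tl.
  by case: (b).
- move=> t /tV[ABt et jt tl tM].
  have [|s [te es sa sl]] := @source_exists _ e t (fun=> m.2) et; first by rewrite eqxx orbT.
  have ABs : between A B (sedges s) by rewrite -(setU1K es) -te between_D1.
  exists s => //; apply/markedP; rewrite between_del ABs es; split=> //.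
  by apply: marks_away_source tM => //; rewrite near_label // sl.
Qed.

(** Since v_+ is the unit, the merge along [e] only forgets a new component that
    is labelled v_+. *)
Lemma cancel_merge d : e \in Q -> flat A (B :\ e) Q' ->
    convex (@dcoef G) (marked A (B :\ e) ((q, true) |: M) :|: marked (e |: A) B M) ->
  exact_at (@dcoef G) (@dgr G)
    (marked A (B :\ e) ((q, true) |: M) :|: marked (e |: A) B M) d.
Proof.
move=> eQ flatQ' cU; have qE : q = arc_at (e, ~~ b) by rewrite /q eQ addbT.
have jT := joins_half flatQ'.
have sW s : s \in marked A (B :\ e) ((q, true) |: M) -> [/\ between A B (sedges s),
    e \notin sedges s, joins (sedges s) e,
    forall b', label s (arc_at (e, b')) = if b' == b then m.2 else true &
    {in M, forall m', label s m'.1 = m'.2}].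
  case/markedU1P => ABs; have := ABs; rewrite between_del => /andP[ABs' es] sq sM.
  split=> //; first exact: jT.
  move=> b'; case: eqP => [->|/eqP b'b].
    by rewrite -(sM m mM) near_label // (negPf es) addbF.
  by rewrite -sq qE; case: (b') (b) b'b => -[].
have tV t : t \in marked (e |: A) B M -> [/\ between A B (sedges t), e \in sedges t,
    ~~ joins (sedges t) e, forall b', label t (arc_at (e, b')) = m.2 &
    {in M, forall m', label t m'.1 = m'.2}].
  case/markedP; rewrite between_add => /andP[ABt et] tM.
  have jt : ~~ joins (sedges t) e.
    rewrite -(setD1K et) joinsU1 ?negbK ?jT ?between_del ?between_D1 //; by rewrite !inE eqxx.
  split=> // b'; rewrite -(tM m mM) near_label // et.
  by rewrite /label (not_joins _ (b (+) true) jt).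
apply: (cancel_along (e := e)) => //.
- by move=> s /sW[].
- by move=> t /tV[].
- move=> s t /sW[_ _ js sl _] /tV[_ _ _ tl _] te sa.
  by rewrite dxiE sa js !sl !tl; case: (b); case: (m.2).
- by move=> s s' /sW[_ _ _ sl _] /sW[_ _ _ sl' _] b'; rewrite sl sl'.
- by move=> t t' /tV[_ _ _ tl _] /tV[_ _ _ tl' _] b'; rewrite tl tl'.
- move=> s /sW[ABs es js sl sM].
  have [|t [te sa tl]] := @target_exists _ e s (fun=> m.2) es; first by rewrite eqxx orbT.
  exists t => //; apply/markedP; rewrite te between_add between_U1 // !inE eqxx; split=> //.
  by apply: marks_away sM => //; rewrite near_label ?te ?between_U1 // tl.
- move=> t /tV[ABt et jt tl tM].
  have ABs : between A (B :\ e) (sedges t :\ e) by rewrite between_del between_D1 // !inE eqxx.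
  have [|s [te es sa sl]] := @source_exists _ e t (fun b' => if b' == b then m.2 else true) et.
    by rewrite jT.
  have sE : sedges s = sedges t :\ e by rewrite te setU1K.
  exists s => //; apply/markedU1P; rewrite sE; split=> //; first by rewrite qE sl; case: (b).
  apply: marks_away_source tM => //; rewrite ?sE ?between_D1 //.
  by rewrite near_label ?sE ?between_D1 // !inE eqxx addbF sl eqxx.
Qed.

End Step.

(** * The homology of a marked subcube *)

Section MarkedHomology.

Variable G : ribbonGraph.
Implicit Types (A B Q T : {set edge G}) (e f : edge G) (a p : bnd_arc G) (s t u : state G).
Implicit Types (M : {set bnd_arc G * bool}) (d : int) (U V W : {set state G}).

Local Notation exact := (exact_at (@dcoef G) (@dgr G)).
Local Notation arrowless := (no_arrow (@dcoef G)).

Lemma in_marked_del A B M e s : e \in B :\: A ->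
  (s \in marked A (B :\ e) M) = (s \in marked A B M) && (e \notin sedges s).
Proof. by rewrite !inE between_del andbAC. Qed.

Lemma in_marked_add A B M e s : e \in B :\: A ->
  (s \in marked (e |: A) B M) = (s \in marked A B M) && (e \in sedges s).
Proof. by rewrite !inE between_add andbAC. Qed.

Lemma in_markedU1 A B M a l s :
  (s \in marked A B ((a, l) |: M)) = (s \in marked A B M) && (label s a == l).
Proof.
apply/markedP/andP => [[ABs sM]|[/markedP[ABs sM] /eqP sa]].
  split; last by apply/eqP; apply: (sM (a, l)); rewrite setU11.
  by apply/markedP; split=> // m mM; apply: sM; rewrite setU1r.
by split=> // m /setU1P[->|/sM].
Qed.

Lemma no_arrow_edge e U V : {in U, forall s, e \in sedges s} ->
  {in V, forall s, e \notin sedges s} -> arrowless U V.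
Proof.
move=> Ue Ve s t sU tV; apply/eqP; apply: contraTT (Ve t tV).
by case/dcoef_neq0 => k _ [-> _]; rewrite negbK !inE Ue ?orbT.
Qed.

Lemma no_arrow_label a U V : {in U, forall s, ~~ label s a} ->
  {in V, forall s, label s a} -> arrowless U V.
Proof.
move=> Ua Va s t sU tV; apply/eqP; apply: contraTT (Ua s sU) => /label_mono st.
by rewrite negbK st // Va.
Qed.

Lemma convex_sub U V : convex (@dcoef G) U -> V \subset U -> arrowless V (U :\: V) ->
  convex (@dcoef G) V.
Proof.
move=> cU /subsetP VU VA s t u sV uV st tu.
have tU := cU _ _ _ (VU _ sV) (VU _ uV) st tu.
apply: contraR st => tV; by rewrite VA // in_setD tV.
Qed.

Lemma convex_quot U V : convex (@dcoef G) U -> arrowless V (U :\: V) ->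
  convex (@dcoef G) (U :\: V).
Proof.
move=> cU VA s t u sW uW st tu; move: (sW) (uW); rewrite !in_setD => /andP[_ sU] /andP[_ uU].
rewrite (cU _ _ _ sU uU st tu) andbT; apply: contraR tu; rewrite negbK => tV.
by rewrite VA.
Qed.

Lemma transversal_eq M Q T : (forall a, bcomp T a = bcomp Q a) ->
  transversal M Q -> transversal M T.
Proof. by move=> TQ [cov inj]; split=> [a|m m' mM m'M]; rewrite !TQ; [apply: cov|apply: inj]. Qed.

Lemma cards_toggle e T : #|toggle e T|%:Z = #|T|%:Z + (if e \in T then -1 else 1).
Proof.
rewrite /toggle; case: ifPn => eT; last by rewrite cardsU1 eT; lia.
by rewrite [in RHS](cardsD1 e) eT; lia.
Qed.

(** Only the vertices of the subcube with the fewest boundary components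
    contribute to the homology, each in one diagonal grading. Induction on the
    dimension of the subcube, along the band [e] found by [first_band]. If the
    minimum is attained both with and without [e], both halves satisfy the
    induction hypothesis. Otherwise a new mark divides the basis of the worse
    half in two: one part cancels against the better half, the other is a marked
    cube again, and its new mark makes up for the change in the number of
    edges. *)
Theorem marked_exact A B M Q d : flat A B Q -> transversal M Q ->
    (forall T, between A B T -> #|bcomps T| = #|bcomps Q| ->
       d != marks_sum M + 1 - #|T|%:Z) ->
  exact (marked A B M) d.
Proof.
move: {2}#|B :\: A| (erefl #|B :\: A|) => n.
elim: n => [|n IHn] in A B M Q d *.
  move=> /eqP; rewrite cards_eq0 => /eqP BA fQ tQ dQ x xU _; exists (fun=> 0).
    by move=> s; rewrite eqxx.
  move=> t tU; rewrite /diff big1 => [|s _]; last by rewrite mul0r.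
  apply/esym/eqP; have [ABQ _] := fQ; apply: contraT => /xU[_ td].
  move: tU => /markedP[ABt tM]; have tE : sedges t = Q.
    by apply/setP => e; apply: between_eq ABt ABQ; rewrite BA inE.
  by have := dQ Q ABQ erefl; rewrite -td (dgr_marked tQ tE tM) eqxx.
move=> BAn fQ tQ dQ; have BA0 : B :\: A != set0 by rewrite -card_gt0 BAn.
have [m [e [b [mM eBA near]]]] := first_band fQ tQ BA0.
have cardE : #|(B :\: A) :\ e| = n.
  by have := cardsD1 e (B :\: A); rewrite eBA BAn => -[].
have card_add : #|B :\: (e |: A)| = n by rewrite setUC -setDDl.
have card_del : #|(B :\ e) :\: A| = n by rewrite setDDl setUC -setDDl.
have subA : A \subset e |: A by apply: subsetUr.
have subB : B :\ e \subset B by apply: subsetDl.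
have cU := @marked_convex G A B M.
have arrow_edge (U V : {set state G}) : U \subset marked (e |: A) B M ->
    V \subset marked A (B :\ e) M -> arrowless U V.
  move=> /subsetP UE /subsetP VE; apply: (@no_arrow_edge e) => s.
    by move/UE; rewrite in_marked_add // => /andP[].
  by move/VE; rewrite in_marked_del // => /andP[].
have [/existsP[Q2 /and3P[ABQ2 /eqP FQ2 eQ2]]|noQ2] := boolP [exists Q2,
    [&& between A B Q2, #|bcomps Q2| == #|bcomps Q| & (e \in Q2) != (e \in Q)]].
  have [ABQ _] := fQ.
  have min c : exists Q0, [/\ between A B Q0, #|bcomps Q0| = #|bcomps Q| & (e \in Q0) = c].
    case: (eqVneq (e \in Q) c) => [eQ|eQ]; first by exists Q.
    by exists Q2; split=> //; case: (e \in Q2) (e \in Q) (c) eQ2 eQ => -[] [].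
  have VE : marked A B M :\: marked (e |: A) B M = marked A (B :\ e) M.
    apply/setP => s; rewrite in_setD in_marked_add // in_marked_del //.
    by case: (s \in marked A B M); case: (e \in sedges s).
  have sub A' B' Q0 : A \subset A' -> B' \subset B -> #|B' :\: A'| = n ->
      between A' B' Q0 -> between A B Q0 -> #|bcomps Q0| = #|bcomps Q| ->
      exact (marked A' B' M) d.
    move=> AA' B'B n' ABQ' ABQ0 F0; apply: (IHn A' B' M Q0) => //.
    - exact: flat_subcube (flat_eq fQ ABQ0 F0) _ _ _.
    - by apply: transversal_eq tQ => a; apply: flat_bcomp fQ ABQ0 F0.
    - move=> T /andP[A'T TB'] FT; apply: dQ; last by rewrite FT.
      by rewrite /between (subset_trans AA' A'T) (subset_trans TB' B'B).
  apply: (exact_extension (@dcoef_square G) (@dcoef_dgr G) (V := marked (e |: A) B M)) => //.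
  - by apply/subsetP => s; rewrite in_marked_add // => /andP[].
  - by rewrite VE; apply: arrow_edge.
  - have [Q0 [AB0 F0 eQ0]] := min true; apply: (sub _ _ Q0) => //.
    by rewrite between_add AB0.
  - rewrite VE; have [Q0 [AB0 F0 eQ0]] := min false; apply: (sub _ _ Q0) => //.
    by rewrite between_del AB0 eQ0.
have {noQ2} uniqe T : between A B T -> #|bcomps T| = #|bcomps Q| -> (e \in T) = (e \in Q).
  move=> ABT FT; apply/eqP; move: noQ2 => /existsPn/(_ T).
  by rewrite ABT FT eqxx /= negbK.
have [ABQ jQ] := fQ; set Q' := toggle e Q; set q := arc_at (e, b (+) (e \in Q)).
have ABQ' : between A B Q' by apply: between_toggle.
have FQ' : #|bcomps Q'| = #|bcomps Q|.+1.
  by have := card_toggle e Q; rewrite (negPf (jQ e eBA)) addn0 addn1.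
(* If a band met two components of [Q'], toggling it would give a minimum in the
   half of [Q']. *)
have flat' A' B' : A \subset A' -> B' \subset B -> e \notin B' :\: A' -> between A' B' Q' ->
    flat A' B' Q'.
  move=> AA' B'B eN' ABQ1; split=> // f fBA'; apply/negP => jf.
  have fBA := subsetP (setDSS B'B AA') _ fBA'.
  have ABT : between A B (toggle f Q') by apply: between_toggle.
  have FT : #|bcomps (toggle f Q')| = #|bcomps Q|.
    by have := card_toggle f Q'; rewrite jf FQ' /= addn1 addn2 => -[].
  have := uniqe _ ABT FT; rewrite !in_toggle eqxx.
  by case: eqP => [ef|_]; [move: eN'; rewrite ef fBA'|case: (e \in Q)].
have tQ' l := transversal_toggle fQ tQ eBA mM near l.
have dQ' l A' B' T : flat A' B' Q' -> between A' B' T -> between A B T ->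
    #|bcomps T| = #|bcomps Q'| -> l = (e \notin Q) -> (e \in T) = (e \notin Q) ->
    d != marks_sum ((q, l) |: M) + 1 - #|T|%:Z.
  move=> fQ' ABT' ABT FT lE eT; rewrite (marks_sum_toggle fQ tQ eBA mM near).
  have jT : joins T e.
    rewrite /joins !(flat_bcomp _ fQ' ABT' FT) -/(joins _ _).
    exact: joins_toggleQ fQ eBA.
  have := dQ _ (between_toggle eBA ABT); rewrite cards_toggle eT lE.
  have := card_toggle e T; rewrite jT FT FQ' => FT'.
  have /[swap]/[apply] : #|bcomps (toggle e T)| = #|bcomps Q| by move: FT'; rewrite /= addn1 addn2 => -[].
  apply: contra => /eqP ->; apply/eqP; rewrite /sgn; case: (e \in Q) => /=; ring.
have [eQ|eQ] := boolP (e \in Q).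
- have ABQ1 : between A (B :\ e) Q'.
    by rewrite between_del ABQ' in_toggle eqxx eQ.
  have fQ' : flat A (B :\ e) Q' by apply: flat' => //; rewrite !inE eqxx andbF.
  set V := marked A (B :\ e) ((q, false) |: M).
  have VE : marked A B M :\: V =
      marked A (B :\ e) ((q, true) |: M) :|: marked (e |: A) B M.
    apply/setP => s; rewrite in_setD in_setU !in_markedU1 in_marked_del // in_marked_add //.
    by case: (s \in _); case: (label s q); case: (e \in sedges s).
  have VA : arrowless V (marked A B M :\: V).
    rewrite VE => s t sV; rewrite in_setU => /orP[tV|].
      by apply: (no_arrow_label (a := q)) sV tV => u; rewrite in_markedU1 => /andP[_ /eqP ->].
    exact: (no_arrow_merge fQ eBA mM near eQ fQ').
  apply: (exact_extension (@dcoef_square G) (@dcoef_dgr G) (V := V)) => //.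
  + by apply/subsetP => s; rewrite in_markedU1 in_marked_del // => /andP[/andP[]].
  + apply: (IHn A (B :\ e) _ Q') => // T ABT FT; apply: (dQ' false A (B :\ e)) => //.
    * by move: ABT; rewrite between_del => /andP[].
    * by rewrite eQ.
    * by move: ABT; rewrite between_del eQ => /andP[_ /negPf].
  + rewrite VE; apply: (cancel_merge fQ tQ eBA mM near) => //.
    by rewrite -/q -VE; apply: convex_quot.
- have ABQ1 : between (e |: A) B Q'.
    by rewrite between_add ABQ' in_toggle eqxx (negPf eQ).
  have fQ' : flat (e |: A) B Q' by apply: flat' => //; rewrite !inE eqxx.
  set V := marked A (B :\ e) M :|: marked (e |: A) B ((q, false) |: M).
  have VE : marked A B M :\: V = marked (e |: A) B ((q, true) |: M).
    apply/setP => s; rewrite in_setD in_setU !in_markedU1 in_marked_del // in_marked_add //.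
    by case: (s \in _); case: (label s q); case: (e \in sedges s).
  have VA : arrowless V (marked A B M :\: V).
    rewrite VE => s t; rewrite in_setU => /orP[sV|sV tV].
      exact: (no_arrow_split fQ eBA mM near eQ fQ').
    by apply: (no_arrow_label (a := q)) sV tV => u; rewrite in_markedU1 => /andP[_ /eqP ->].
  have VU : V \subset marked A B M.
    apply/subsetP => s; rewrite in_setU in_markedU1 in_marked_del // in_marked_add //.
    by case: (s \in _).
  apply: (exact_extension (@dcoef_square G) (@dcoef_dgr G) (V := V)) => //.
  + apply: (cancel_split fQ tQ eBA mM near) => //; exact: convex_sub cU VU VA.
  + rewrite VE; apply: (IHn (e |: A) B _ Q') => // T ABT FT; apply: (dQ' true (e |: A) B) => //.
    * by move: ABT; rewrite between_add => /andP[].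
    * by move: ABT; rewrite between_add => /andP[_ ->].
Qed.

End MarkedHomology.

(** * Euler characteristic *)

Section Euler.

Variable G : ribbonGraph.
Implicit Types (A B Q T : {set edge G}) (e f : edge G) (a p : bnd_arc G).

(** Toggling an edge changes the number of boundary components by one. *)
Lemma bcomps_between A B : A \subset B ->
  [/\ (#|bcomps A| <= #|bcomps B| + #|B :\: A|)%N,
      (#|bcomps B| <= #|bcomps A| + #|B :\: A|)%N &
      ~~ odd (#|bcomps A| + #|bcomps B| + #|B :\: A|)].
Proof.
move: {2}#|B :\: A| (erefl #|B :\: A|) => n; elim: n => [|n IHn] in A *.
  move=> BA0 AB; have -> : A = B.
    by apply/eqP; rewrite eqEsubset AB -setD_eq0 -cards_eq0 BA0.
  by rewrite setDv cards0 !addn0 leqnn addnn odd_double.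
move=> BAn AB; have /card_gt0P[e eBA] : (0 < #|B :\: A|)%N by rewrite BAn.
have [eA eB] : e \notin A /\ e \in B by move: eBA; rewrite in_setD => /andP[].
have An : #|B :\: (e |: A)| = n.
  by rewrite setUC -setDDl; have := cardsD1 e (B :\: A); rewrite eBA BAn => -[].
have [|le1 le2 ev] := IHn (e |: A) An; first by rewrite subUset sub1set eB.
move: le1 le2 ev (card_bcompsU1 eA); rewrite An BAn.
move: #|bcomps A| #|bcomps B| #|bcomps (e |: A)| (joins A e) => a b c j.
clear; case: j => /= *; split; lia.
Qed.

Definition arc_vert a : vertex G :=
  match a with inl x => @vert G x | inr w => val w end.

Lemma arc_vert_surj w : exists a, arc_vert a = w.
Proof.
have [/codomP[x wx]|wN] := boolP (w \in codom (@vert G)); first by exists (inl x).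
by exists (inr (exist _ w wN)).
Qed.

(** Without bands the boundary walk is the rotation around a vertex. *)
Lemma arc_vert_eq a b : (arc_vert a == arc_vert b) = (a \in bcomp set0 b).
Proof.
have vN c : arc_vert (bnd_perm set0 c) = arc_vert c.
  rewrite (permE (@bnd_next_inj G _)); case: c => //= x; rewrite /cross inE.
  by apply/esym/eqP; rewrite rot_vert; have := mem_porbit (Defs.rot G) 1 x; rewrite expg1.
apply/idP/idP => [/eqP ab|/porbitP[k ->]]; last first.
  by elim: k => [|k IHk]; rewrite ?expg0 ?perm1 // expgSr permM vN.
case: a b ab => [x|w] [y|w'] /= ab.
- move/eqP: ab; rewrite eq_sym rot_vert => /porbitP[k ->]; apply/porbitP; exists k.
  elim: k => [|k IHk]; first by rewrite !expg0 !perm1.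
  by rewrite !expgSr !permM -IHk (permE (@bnd_next_inj G _)) /= /cross inE.
- by case: w' ab => w' /= wN E; case/negP: (wN); rewrite -E codom_f.
- by case: w ab => w /= wN E; case/negP: (wN); rewrite E codom_f.
by rewrite (val_inj ab) bcomp_id.
Qed.

Lemma card_bcomps0 : #|bcomps (set0 : {set edge G})| = #|vertex G|.
Proof.
pose fib w := [set a | arc_vert a == w].
have fibE a : fib (arc_vert a) = bcomp set0 a.
  by apply/setP => b; rewrite inE arc_vert_eq.
have -> : bcomps set0 = fib @: [set: vertex G].
  apply/setP => c; apply/idP/imsetP => [/mem_porbits[a ->]|[w _ ->]].
    by exists (arc_vert a); rewrite ?fibE.
  by have [a <-] := arc_vert_surj w; rewrite fibE bcomp_in_bcomps.
rewrite card_in_imset ?cardsT // => w w' _ _ ww'; have [a aw] := arc_vert_surj w.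
have : a \in fib w' by rewrite -ww' inE aw.
by rewrite inE aw => /eqP.
Qed.

Lemma card_face : #|face G| = #|bcomps [set: edge G]|.
Proof. by rewrite card_sig. Qed.

Hypothesis connG : connected_graph G.

(** A flat vertex of the whole cube has all of the boundary in one component:
    it is closed under the rotation and under crossing any edge. *)
Lemma flat_connected Q a b : flat set0 [set: edge G] Q -> bcomp Q a = bcomp Q b.
Proof.
move=> [_ jQ]; have cr e c c' : bcomp Q (arc_at (e, c)) = bcomp Q (arc_at (e, c')).
  by apply: not_joins; apply: jQ; rewrite !inE.
have rotQ x : bcomp Q (arc_at (Defs.rot G x)) = bcomp Q (arc_at x).
  rewrite -[RHS]bcomp_next (permE (@bnd_next_inj G _)) /= /cross.
  by case: (Defs.rot G x) => e c /=; case: ifP => _; apply: cr.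
have vertQ x y : vert x = vert y -> bcomp Q (arc_at x) = bcomp Q (arc_at y).
  move/eqP; rewrite rot_vert => /porbitP[k ->].
  by elim: k => [|k IHk]; rewrite ?expg0 ?perm1 // expgSr permM rotQ.
have pathQ s x y : path (@adj G) (vert x) s -> last (vert x) s = vert y ->
    bcomp Q (arc_at x) = bcomp Q (arc_at y).
  elim: s x => [|w s IHs] x /=; first by move=> _; apply: vertQ.
  case/andP => /existsP[[e c] /= /andP[/eqP vx /eqP <-]] ps ls.
  by rewrite -(IHs _ ps ls) -(vertQ _ _ vx); apply: cr.
have iso (v w : vertex G) : v \notin codom (@vert G) -> v = w.
  move=> vN; have /connectP[[|w' s] /= vs ->] := connG v w; first by [].
  by case/andP: vs => /existsP[x /andP[/eqP xv _]]; rewrite -xv codom_f in vN.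
case: a b => [x|v] [y|w].
- by have /connectP[s ps ls] := connG (vert x) (vert y); apply: pathQ ps (esym ls).
- by case: w => w wN; case/negP: (wN); rewrite (iso _ (vert x) wN) codom_f.
- by case: v => v vN; case/negP: (vN); rewrite (iso _ (vert y) vN) codom_f.
by congr (bcomp Q (inr _)); apply/val_inj/iso; exact: (valP v).
Qed.

Lemma flat_card1 Q : flat set0 [set: edge G] Q -> #|bcomps Q| = 1%N.
Proof.
move=> fQ; have /card_gt0P[c /mem_porbits[a _]] := bcomps_gt0 (set0 : {set edge G}).
apply/eqP/cards1P; exists (bcomp Q a); apply/setP => d; rewrite inE.
apply/idP/eqP => [/mem_porbits[b ->]|->]; last exact: bcomp_in_bcomps.
exact: (flat_connected b a fQ).
Qed.

(** A spanning subgraph with one boundary component has at least the edges needed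
    to connect the disks, and its complement at least those needed to connect the
    faces. *)
Lemma quasitree_card Q : #|bcomps Q| = 1%N ->
  (#|vertex G| <= #|Q| + 1)%N /\ (#|Q| + #|face G| <= nedge G + 1)%N.
Proof.
move=> Q1; rewrite card_face; have [le1 _ _] := bcomps_between (sub0set Q).
have [_ le2 _] := bcomps_between (subsetT Q).
have := cardsD [set: edge G] Q; rewrite setTI cardsT card_ord => QE.
have := subset_leq_card (subsetT Q); rewrite cardsT card_ord => QE'.
move: le1 le2; rewrite card_bcomps0 setD0 Q1 QE; lia.
Qed.

(** The truncated subtraction and the halving in the definition of the genus are
    exact: a spanning subgraph with one boundary component bounds the difference,
    and its parity is that of the number of toggles from no edge to all. *)
Lemma genusE : (2 * genus G + #|vertex G| + #|face G| = nedge G + 2)%N.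
Proof.
have n1 : n_comp (@adj G) predT = 1%N.
  have /card_gt0P[v _] := vertex_gt0 G.
  have sym : connect_sym (@adj G).
    by move=> x y; rewrite !connG.
  rewrite -(n_comp_connect sym v); apply: eq_n_comp_r => w.
  by rewrite !inE connG.
have [Q fQ] := flat_min (sub0set [set: edge G]).
have [le1 le2] := quasitree_card (flat_card1 fQ).
have [_ _] := bcomps_between (sub0set [set: edge G]).
rewrite setD0 cardsT card_ord card_bcomps0 -card_face /genus n1.
move: (nedge G) #|vertex G| #|face G| #|Q| le1 le2 => n v f q le1 le2.
lia.
Qed.

End Euler.

(** * Reduced homology *)

Section ReducedHomology.

Local Open Scope quotient_scope.

Variables (G : ribbonGraph) (p : bnd_arc G).
Implicit Types (Q T : {set edge G}) (e f : edge G) (s t : state G) (i j d : int).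

Definition reduced : {set state G} := [set s | reduced_state p s].

Lemma reducedE : reduced = marked set0 setT [set (p, false)].
Proof.
apply/setP => s; apply/idP/markedP => [|[_ /(_ (p, false))]].
  rewrite inE => ps; split; first by rewrite /between sub0set subsetT.
  by move=> m /set1P ->; apply/negbTE.
by rewrite set11 inE /reduced_state => /(_ isT) /= /negbT.
Qed.

(** The reduced complex is the whole cube with one mark, labelled v_-; its
    minima are the spanning quasi-trees. *)
Lemma reduced_exact d : connected_graph G ->
    (forall Q, #|bcomps Q| = 1%N -> d != - #|Q|%:Z) ->
  exact_at (@dcoef G) (@dgr G) reduced d.
Proof.
move=> connG dQ; have [Q fQ] := flat_min (sub0set [set: edge G]).
have Q1 := flat_card1 connG fQ; rewrite reducedE; apply: (marked_exact fQ).
  split=> [a|m m' /set1P -> /set1P -> //]; exists (p, false); first exact: set11.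
  by rewrite -bcomp_eq; apply/eqP/(flat_connected connG _ _ fQ).
move=> T _; rewrite Q1 /marks_sum big_set1 /= => /dQ; apply: contra => /eqP ->.
by apply/eqP; rewrite /sgn; ring.
Qed.

Lemma kh_diffE (c : CKh G) t : kh_diff c t = diff (@dcoef G) c t.
Proof. by rewrite ffunE. Qed.

Lemma rCKhP i j (c : CKh G) :
  reflect (forall s, c s != 0 -> [/\ s \in reduced, hdeg s = i & qdeg s + 1 = j])
          (c \in rCKh p i j).
Proof.
apply: (iffP forallP) => H s.
  by move=> cs; have := H s; rewrite cs => /and3P[sr /eqP-> /eqP->]; rewrite inE.
apply/implyP => /H[]; rewrite inE => -> -> ->; by rewrite !eqxx.
Qed.

Lemma dcoef_deg s t : dcoef s t != 0 -> hdeg t = hdeg s + 1 /\ qdeg t = qdeg s.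
Proof.
case/dcoef_neq0 => e es [te]; rewrite (hdegU1 es te) (dxi_leexi es te).
by have [->|_] := eqVneq (qdeg t) (qdeg s); rewrite ?eqxx.
Qed.

Lemma dcoef_reduced s t : s \in reduced -> dcoef s t != 0 -> t \in reduced.
Proof.
rewrite !inE => sr st; apply: contra sr; exact: (label_mono (a := p) st).
Qed.

(** A primitive in the diagonal grading can be replaced by its component of the
    right bidegree. *)
Lemma exact_boundary i j (c : CKh G) :
    exact_at (@dcoef G) (@dgr G) reduced (j - 2 * i) ->
    c \in rcycle p i j ->
  exists2 c' : CKh G, c' \in rCKh p (i - 1) j & c = kh_diff c'.
Proof.
move=> ex /andP[/rCKhP cij /eqP dc].
have [s /cij[sr si sj]|t _|y yr yc] := ex c; first by rewrite /dgr si sj.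
  by rewrite -kh_diffE dc ffunE.
pose c' : CKh G := [ffun s => if (hdeg s == i - 1) && (qdeg s + 1 == j) then y s else 0].
exists c'.
  apply/rCKhP => s; rewrite ffunE; case: ifP => [/andP[/eqP-> /eqP->] ys|_]; last by rewrite eqxx.
  by have [] := yr s ys.
apply/ffunP => t; rewrite kh_diffE.
have [tr|tr] := boolP (t \in reduced); last first.
  have [->|/cij[]] := eqVneq (c t) 0; last by rewrite (negPf tr).
  rewrite /diff big1 // => s _; rewrite ffunE; case: ifP => _; last by rewrite mul0r.
  apply/eqP; apply: contraR tr; rewrite mulf_eq0 negb_or => /andP[/yr[sr _]].
  exact: dcoef_reduced.
have [tij|tij] := boolP ((hdeg t == i) && (qdeg t + 1 == j)).
  rewrite -yc //; apply: eq_bigr => s _; rewrite ffunE.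
  have [->|/dcoef_deg[ht qt]] := eqVneq (dcoef s t) 0; first by rewrite !mulr0.
  by move: tij; rewrite ht qt => /andP[/eqP <- ->]; rewrite addrK eqxx.
have -> : c t = 0.
  by apply/eqP; apply: contraR tij => /cij[_ -> ->]; rewrite !eqxx.
rewrite /diff big1 // => s _; rewrite ffunE; case: ifP => [/andP[/eqP hs /eqP qs]|_]; last first.
  by rewrite mul0r.
have [->|/dcoef_deg[ht qt]] := eqVneq (dcoef s t) 0; first by rewrite mulr0.
by move: tij; rewrite ht qt hs qs subrK !eqxx.
Qed.

Lemma rKh_quasitree i j (x : rKh p i j) : connected_graph G -> x != 0 ->
  exists2 Q : {set edge G}, #|bcomps Q| = 1%N & j - 2 * i = - #|Q|%:Z.
Proof.
move=> connG x0; have [/existsP[Q /andP[/eqP Q1 /eqP jQ]]|no] :=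
    boolP [exists Q : {set edge G}, (#|bcomps Q| == 1%N) && (j - 2 * i == - #|Q|%:Z)].
  by exists Q.
have ex : exact_at (@dcoef G) (@dgr G) reduced (j - 2 * i).
  apply: reduced_exact => // Q Q1; apply: contra no => jQ.
  by apply/existsP; exists Q; rewrite Q1 eqxx.
case/negP: x0; elim/quotW: x => z.
have -> : (0 : rKh p i j) = \pi_(rKh p i j) 0 by rewrite raddf0.
rewrite -Quotient.idealrBE subr0; apply/asboolP.
exact: exact_boundary ex (rcycleP z).
Qed.

(** A basis state with no arrow in or out is a homology class by itself. *)
Lemma rKh_generator s : s \in reduced -> (forall t, dcoef s t = 0) ->
    (forall t, t \in reduced -> dcoef t s = 0) ->
  exists x : rKh p (hdeg s) (qdeg s + 1), x != 0.
Proof.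
move=> sr ds d's; pose c : CKh G := [ffun t => (t == s)%:R].
have cP : c \in rcycle p (hdeg s) (qdeg s + 1).
  apply/andP; split.
    by apply/rCKhP => t; rewrite ffunE; have [->|_] := eqVneq t s; rewrite ?eqxx.
  apply/eqP/ffunP => t; rewrite !ffunE big1 // => u _; rewrite ffunE.
  by have [->|_] := eqVneq u s; rewrite ?ds ?mulr0 ?mul0r.
exists (\pi_(rKh p (hdeg s) (qdeg s + 1)) (RCycle cP)).
have -> : (0 : rKh p (hdeg s) (qdeg s + 1)) = \pi_(rKh p (hdeg s) (qdeg s + 1)) 0.
  by rewrite raddf0.
rewrite -Quotient.idealrBE subr0; apply/asboolP => -[c' /rCKhP c'P /= cE].
have := kh_diffE c' s; rewrite -cE ffunE eqxx /diff big1 // => t _.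
have [->|/c'P[tr _ _]] := eqVneq (c' t) 0; first by rewrite mul0r.
by rewrite d's ?mulr0.
Qed.

Lemma diag_generator s : s \in reduced -> (forall t, dcoef s t = 0) ->
    (forall t, t \in reduced -> dcoef t s = 0) ->
  diag_nonzero (@rKh G p) ((dgr s)%:~R / 2).
Proof.
move=> sr ds d's; exists (hdeg s), (qdeg s + 1); split; last exact: rKh_generator.
by rewrite /dgr rmorphB rmorphM /=; lra.
Qed.

(** Without loops every band merges two disks, and v_- * v_- = 0: the state that
    labels every disk v_- is a cycle, in the lowest homological degree. *)
Lemma diag_max : ~ has_loop G ->
  diag_nonzero (@rKh G p) ((1 - #|vertex G|%:Z)%:~R / 2).
Proof.
move=> noloop; pose s := mkstate (set0 : {set edge G}) set0.
have sl a : label s a = false by rewrite label_mk inE.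
have -> : 1 - #|vertex G|%:Z = dgr s.
  rewrite /dgr qdeg_sum /hdeg sedges_mk cards0 -card_bcomps0.
  rewrite (eq_bigr (fun=> -1)) => [|c _]; last by rewrite splus_mk set0I inE.
  by rewrite sumr_const mulNrn natz; ring.
apply: diag_generator => [|t|t _]; first by rewrite inE; apply/negbT/sl.
- apply/eqP; apply: contraT => /dcoef_neq0[e es [te]]; rewrite dxiE !sl.
  have -> : joins (sedges s) e; last by case: ifP.
  apply: contra_notN noloop => /eqP E; exists e; apply/eqP.
  by rewrite -[_ == _]/(arc_vert (inl _) == arc_vert (inl _)) arc_vert_eq -bcomp_eq; apply/eqP.
apply/eqP; apply: contraT => /dcoef_neq0[e _ [te _]].
by have := setU11 e (sedges t); rewrite -te inE.
Qed.

(** Without loops in the dual graph the two sides of the last band are distinct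
    components, so this band splits one, and no term of Delta gives v_+ to both
    sides. The state that labels every face v_+, except the marked one, is
    therefore not hit, in the highest homological degree. *)
Lemma diag_min : ~ has_loop (dual_graph G) ->
  diag_nonzero (@rKh G p) ((#|face G|%:Z - 1 - (nedge G)%:Z)%:~R / 2).
Proof.
move=> noloop; pose s := mkstate [set: edge G] (~: [set bcomp [set: edge G] p]).
have sl a : label s a = (bcomp setT a != bcomp setT p) by rewrite label_mk !inE.
have -> : #|face G|%:Z - 1 - (nedge G)%:Z = dgr s.
  rewrite /dgr qdeg_sum /hdeg sedges_mk cardsT card_ord card_face.
  rewrite (big_setD1 (bcomp setT p)) ?bcomp_in_bcomps //= splus_mk !inE eqxx /=.
  rewrite (eq_bigr (fun=> 1)) => [|c]; last by rewrite !inE => /andP[-> ->].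
  rewrite sumr_const (cardsD1 (bcomp setT p) (bcomps _)) bcomp_in_bcomps PoszD.
  by rewrite (natz #|bcomps [set: edge G] :\ _|) /=; ring.
apply: diag_generator => [|t|t tr]; first by rewrite inE /reduced_state -/(label _ _) sl eqxx.
  apply/eqP; apply: contraT => /dcoef_neq0[e es _]; by rewrite inE in es.
apply/eqP; apply: contraT => /dcoef_neq0[e et [te]].
have js : joins [set: edge G] e.
  apply: contra_notN noloop => /eqP E; exists e.
  have : face_of (arc_at (e, false)) = face_of (arc_at (e, true)) by apply: val_inj.
  by [].
have jt : ~~ joins (sedges t) e by rewrite -joinsU1 // -te.
rewrite dxiE (negPf jt) !sl; case: ifP => // _.
have tp : label t p = false by apply/negbTE; move: tr; rewrite inE.
have tl b : bcomp setT (arc_at (e, b)) = bcomp setT p -> label t (arc_at (e, false)) = false.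
  move=> eb; rewrite -[RHS]tp; apply/esym/label_bcomp.
  have : p \in bcomp (sedges t) (arc_at (e, false)) :|: bcomp (sedges t) (arc_at (e, true)).
    by rewrite -bcompU1 // -te sedges_mk; case: (b) eb => ->; rewrite inE bcomp_id ?orbT.
  by rewrite inE -!bcomp_eq; move: jt; rewrite negbK => /eqP <-; rewrite orbb.
have [E0|_] := eqVneq (bcomp setT (arc_at (e, false))) (bcomp setT p).
  have -> : bcomp setT (arc_at (e, true)) != bcomp setT p by rewrite -E0 eq_sym.
  by rewrite (tl false E0).
have [E1|_] := eqVneq (bcomp setT (arc_at (e, true))) (bcomp setT p).
  by rewrite (tl true E1).
by case: (label t _).
Qed.

End ReducedHomology.

Theorem corollary8p2 (G : ribbonGraph) (p : bnd_arc G) :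
  connected_graph G -> adequate G -> hw_eq (@rKh G p) ((genus G)%:R + 1).
Proof.
move=> connG [noloop nodual].
exists ((1 - #|vertex G|%:Z)%:~R / 2), ((#|face G|%:Z - 1 - (nedge G)%:Z)%:~R / 2).
have gE := genusE connG; split.
- exact: diag_max.
- exact: diag_min.
- move=> _ [i [j [-> [x x0]]]]; have [Q Q1 jQ] := rKh_quasitree connG x0.
  have [le1 le2] := quasitree_card Q1.
  have -> : j%:~R / 2 - i%:~R = (- #|Q|%:Z)%:~R / 2 :> rat.
    by rewrite -jQ rmorphB rmorphM /=; field.
  by rewrite !ler_pM2r ?invr_gt0 // !ler_int; lia.
have -> : (genus G)%:R = (genus G)%:Z%:~R :> rat by [].
suff : 2 * (genus G)%:Z = (1 - #|vertex G|%:Z) - (#|face G|%:Z - 1 - (nedge G)%:Z).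
  by move/(congr1 (fun z : int => z%:~R : rat)); rewrite rmorphB rmorphM /=; lra.
by move: gE; lia.
Qed.
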